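(* Let $p$ be a polynomial of degree $d>1$ with real Julia set $\mathcal{J}(p)\subset\mathbb{R}$. Then for any fixed point $\xi$ of $p$ with $\min\mathcal{J}(p)<\xi<\max\mathcal{J}(p)$ we have $|p'(\xi)|\geq d$. Furthermore, $|p'(\min\mathcal{J}(p))|\geq d^2$ and $|p'(\max\mathcal{J}(p))|\geq d^2$. Equality in one of these inequalities implies that $p$ is linearly conjugate to the Chebyshev polynomial $T_d$ of degree $d$.
   Context: $T_d$ is the Chebyshev polynomial of the first kind. Two polynomials $p,q$ are linearly conjugate if $q=L\circ p\circ L^{-1}$ for some map $L(z)=az+b$, $a\neq0$.
   Formalization: In the equality case, for odd d the conclusion is that p is linearly conjugate to T_d or to −T_d, because the claim with T_d alone fails for p = −T_3 (Julia set [−1,1], equality everywhere, not conjugate to T_3); for even d it is as stated. *)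

(* Defs.v *)
From HB Require Import structures.
From mathcomp Require Import all_boot all_order all_algebra.
From mathcomp Require Import all_classical all_reals.
From mathcomp Require Export complex.

Set Implicit Arguments.
Unset Strict Implicit.
Unset Printing Implicit Defensive.

Import Order.TTheory GRing.Theory Num.Theory.

Local Open Scope classical_set_scope.
Local Open Scope ring_scope.
Local Open Scope complex_scope.

Notation cmod := ComplexField.Normc.normc.

Definition chordal (R : realType) (z w : R[i]) : R :=
  2 * cmod (z - w) /
  (Num.sqrt (1 + cmod z ^+ 2) * Num.sqrt (1 + cmod w ^+ 2)).

Definition iterates_equicontinuous_at (R : realType) (p : {poly R[i]})
    (w : R[i]) : Prop :=
  forall eps : R, 0 < eps -> exists2 delta : R, 0 < delta &
    forall (w' : R[i]) (n : nat), chordal w w' < delta ->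
      chordal (iter n (horner p) w) (iter n (horner p) w') < eps.

(* Only the finite part of the Fatou set: for a polynomial of degree at least 2
   the point at infinity is a superattracting fixed point, so it is always in
   the Fatou set and the Julia set is a subset of the plane. *)
Definition fatou (R : realType) (p : {poly R[i]}) : set R[i] :=
  [set z | exists2 r : R, 0 < r &
    forall w : R[i], cmod (w - z) < r -> iterates_equicontinuous_at p w].

Definition julia (R : realType) (p : {poly R[i]}) : set R[i] := ~` fatou p.

Definition real_trace (R : realType) (A : set R[i]) : set R :=
  [set x : R | A x%:C].

Definition is_minimum (R : realType) (A : set R) (m : R) : Prop :=
  A m /\ lbound A m.

Definition is_maximum (R : realType) (A : set R) (m : R) : Prop :=
  A m /\ ubound A m.

Fixpoint chebyshevT (A : comNzRingType) (n : nat) : {poly A} :=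
  match n with
  | 0 => 1
  | 1 => 'X
  | (m.+1 as k).+1 => 'X *+ 2 * chebyshevT A k - chebyshevT A m
  end.

(* T_d and - T_d are linearly conjugate for even d, through z |-> - z.  For odd
   d > 1 they are not, although both have Julia set [-1, 1]: the fixed point 0
   of - T_3 has multiplier 3, whereas those of T_3 have multipliers -3, 9, 9. *)
Definition linearly_conjugate (F : fieldType) (p q : {poly F}) : Prop :=
  exists a b : F, a != 0 /\
    q = (a *: 'X + b%:P) \Po (p \Po (a^-1 *: ('X - b%:P))).

(* Main.v *)
Require Import Defs.
From HB Require Import structures.
From mathcomp Require Import all_boot all_order all_algebra.
From mathcomp Require Import all_classical all_reals.
From mathcomp Require Import polyorder ring lra.

Set Implicit Arguments.
Unset Strict Implicit.
Unset Printing Implicit Defensive.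

Import Order.TTheory GRing.Theory Num.Theory.

Local Open Scope classical_set_scope.
Local Open Scope ring_scope.
Local Open Scope complex_scope.

(* Let K be the set of points with bounded orbit.  Off K the iterates escape
   locally uniformly, so the Julia set J lies in K.  If J is real then K is real:
   a nonreal point of K is in the Fatou set, equicontinuity makes K open there,
   and the last point of K on a vertical ray gives a contradiction.  By the same
   openness J = K, which is completely invariant.  Hence with a = min K and
   b = max K all roots of p - a and p - b are real and in [a, b]; in particular p
   is real.

   Normalise [a, b] to [-1, 1].  As p - 1 and p + 1 are real-rooted, Laguerre's
   inequality shows |p| >= 1 and p p'' < 0 at every critical point.  Let S be a
   trigonometric polynomial cos (d t + s), written in x = cos t, which agrees with
   p at a point x0.  If p' does not exceed S' there in modulus, then the residues
   of the even part in t of (p - S) / sin^2 ((t - t0) / 2), divided by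
   (1 - x^2) p', all have the same sign; they sum to zero, so p = S, which forces
   S = T_d or S = - T_d.  At a fixed point |S'| = d, and at the end points
   |S'| = d^2. *)

(** * Chebyshev polynomials and interpolation *)

(* [chebyshevU n] is the Chebyshev polynomial of the second kind [U_(n-1)]. *)
Fixpoint chebyshevU (A : comNzRingType) (n : nat) : {poly A} :=
  if n is m.+1 then 'X * chebyshevU A m + chebyshevT A m else 0.

Section Chebyshev.
Variable A : comNzRingType.
Local Notation T := (chebyshevT A).
Local Notation U := (chebyshevU A).

(** With [x = cos t], [T n] is [cos nt] and [U n] is [sin nt / sin t]; this is the addition formula
    for [cos (nt + t)]. *)
Lemma chebyshevTS n : T n.+1 = 'X * T n - (1 - 'X^2) * U n.
Proof.
elim: n => [|n IHn]; first by rewrite /= mulr0 subr0 mulr1.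
have e : (1 - 'X^2) * U n = 'X * T n - T n.+1 by rewrite IHn; ring.
rewrite [U n.+1]/= mulrDr mulrCA e -/(T n.+1).
by rewrite [LHS]/= -/(T n.+1); ring.
Qed.

Lemma chebyshev_pythagoras n : T n ^+ 2 + (1 - 'X^2) * U n ^+ 2 = 1.
Proof.
elim: n => [|n IHn]; first by rewrite /=; ring.
rewrite chebyshevTS [U n.+1]/= -[RHS]IHn; ring.
Qed.

(** Derivatives of [cos nt] and [sin nt / sin t] in [x = cos t], the second cleared of its
    denominator [sin^2 t]. *)
Lemma chebyshev_deriv n :
  (T n)^`() = U n *+ n /\ (1 - 'X^2) * (U n)^`() = 'X * U n - T n *+ n.
Proof.
elim: n => [|n [IHT IHU]].
  by rewrite /= derivC deriv0 !mulr0 !mulr0n subrr.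
split.
  rewrite chebyshevTS !derivE IHT.
  have -> : 'X * (U n *+ n) = 'X * U n *+ n by rewrite mulrnAr.
  rewrite mulrDl ?mulrDr IHU [U n.+1]/=; ring.
rewrite chebyshevTS [U n.+1]/= !derivE IHT mulrDr mulrDr.
have -> : (1 - 'X^2) * ('X * (U n)^`()) = 'X * ('X * U n - T n *+ n).
  by rewrite mulrCA IHU.
ring.
Qed.

Lemma size_chebyshevU n : (size (U n) <= n)%N /\ (size (T n) <= n.+1)%N.
Proof.
elim: n => [|n [IHU IHT]]; first by rewrite /= size_poly0 size_poly1.
have hU : (size (U n.+1) <= n.+1)%N.
  rewrite /= (leq_trans (size_polyD _ _)) // geq_max IHT andbT.
  by rewrite (leq_trans (size_polyMleq _ _)) // size_polyX.
split=> //.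
rewrite chebyshevTS (leq_trans (size_polyD _ _)) // geq_max size_polyN.
rewrite !(leq_trans (size_polyMleq _ _)) ?size_polyX //.
have h2 : (size (1 - 'X^2 : {poly A})%R <= 3)%N.
  rewrite (leq_trans (size_polyD _ _)) // geq_max size_polyN size_polyXn.
  by rewrite size_poly1.
by move: (leq_add h2 IHU); case: (_ + _)%N.
Qed.

End Chebyshev.

Lemma size_chebyshevT (A : comNzRingType) n : (size (chebyshevT A n) <= n.+1)%N.
Proof. by case: (size_chebyshevU A n). Qed.

Section ChebyshevEval.
Variables (A : comNzRingType) (x : A) (n : nat).
Local Notation T := (chebyshevT A).
Local Notation U := (chebyshevU A).

Lemma horner_chebyshev_pythagoras :
  (T n).[x] ^+ 2 + (1 - x ^+ 2) * (U n).[x] ^+ 2 = 1.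
Proof.
by have /(congr1 (horner^~ x)) := chebyshev_pythagoras A n; rewrite !hornerE.
Qed.

Lemma horner_deriv_chebyshevT : (T n)^`().[x] = (U n).[x] *+ n.
Proof. by rewrite (chebyshev_deriv A n).1 hornerMn. Qed.

Lemma horner_deriv_chebyshevU :
  (1 - x ^+ 2) * (U n)^`().[x] = x * (U n).[x] - (T n).[x] *+ n.
Proof.
by have /(congr1 (horner^~ x)) := (chebyshev_deriv A n).2; rewrite !hornerE hornerMn.
Qed.

End ChebyshevEval.

(** The extra factor [e] in the second identity avoids the exponent [n - 1], truncated at
    [n = 0]. *)
Lemma chebyshev_end (A : comNzRingType) (e : A) n : e ^+ 2 = 1 ->
  (chebyshevT A n).[e] = e ^+ n /\ (chebyshevU A n).[e] * e = e ^+ n *+ n.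
Proof.
move=> e2; elim: n => [|n [IHT IHU]]; first by rewrite /= !hornerE.
rewrite chebyshevTS /= !hornerE e2 IHT subrr mul0r subr0 -exprS.
by split=> //; rewrite mulrDl -mulrA IHU -exprSr mulrnAr -exprS mulrSr.
Qed.

Lemma horner_deriv_prod_XsubC (F : fieldType) (rs : seq F) (r : F) :
  r \in rs ->
  (\prod_(s <- rs) ('X - s%:P))^`().[r] = (\prod_(s <- rem r rs) ('X - s%:P)).[r].
Proof.
move=> r_in; rewrite (perm_big _ (perm_to_rem r_in)) big_cons derivM derivXsubC mul1r.
by rewrite !hornerE subrr mul0r addr0.
Qed.

Lemma horner_prod_XsubC_neq0 (F : fieldType) (rs : seq F) (r : F) :
  r \notin rs -> (\prod_(s <- rs) ('X - s%:P)).[r] != 0.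
Proof. by rewrite -root_prod_XsubC. Qed.

(* The sum is the coefficient of degree [size rs - 1] in the Lagrange
   interpolation formula for [g] at the nodes [rs]. *)
Lemma sum_residues (F : fieldType) (rs : seq F) (g : {poly F}) :
  uniq rs -> (size g < size rs)%N ->
  \sum_(r <- rs) g.[r] / (\prod_(s <- rs) ('X - s%:P))^`().[r] = 0.
Proof.
move=> rs_uniq size_g.
pose c r := g.[r] / (\prod_(s <- rs) ('X - s%:P))^`().[r].
pose l r := \prod_(s <- rem r rs) ('X - s%:P) : {poly F}.
have size_l r : r \in rs -> size (l r) = size rs.
  by move=> r_in; rewrite size_prod_XsubC size_rem // prednK //; case: (rs) r_in.
have l0 r t : r \in rs -> t \in rs -> t != r -> (l r).[t] = 0.
  move=> r_in t_in tr; apply/rootP; rewrite root_prod_XsubC.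
  by rewrite (rem_filter _ rs_uniq) mem_filter /= tr t_in.
pose h := g - \sum_(r <- rs) c r *: l r.
have h0 : h = 0.
  apply: (@roots_geq_poly_eq0 _ h rs) => //; last first.
    rewrite (leq_trans (size_polyD _ _)) // geq_max size_polyN (ltnW size_g) /=.
    rewrite big_seq (leq_trans (size_sum _ _ _)) //.
    apply/bigmax_leqP_seq => r r_in _.
    by rewrite (leq_trans (size_scale_leq _ _)) // size_l.
  apply/allP => t t_in; apply/rootP; rewrite hornerD hornerN horner_sum.
  rewrite (big_rem t) //= big_seq big1 ?addr0.
    rewrite hornerZ /c horner_deriv_prod_XsubC // divfK ?subrr //.
    apply: horner_prod_XsubC_neq0.
    by rewrite (rem_filter _ rs_uniq) mem_filter /= eqxx.
  move=> r; rewrite (rem_filter _ rs_uniq) mem_filter => /andP[/= rt r_in].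
  by rewrite hornerZ l0 ?mulr0 // eq_sym.
have := congr1 (fun p : {poly F} => p`_(size rs).-1) h0.
rewrite coefB coef0 coef_sum nth_default; last by case: (size rs) size_g.
move/eqP; rewrite sub0r oppr_eq0 => /eqP hs; rewrite -[RHS]hs.
rewrite [LHS]big_seq [RHS]big_seq; apply: eq_bigr => r r_in; rewrite coefZ -/(c r).
have /monicP := monic_prod_XsubC (rem r rs) xpredT id.
by rewrite -/(l r) lead_coefE size_l // => ->; rewrite mulr1.
Qed.

(** The sign condition makes all terms of [sum_residues] of one sign; their sum is zero, so each
    vanishes and [g] has more roots than its degree allows. *)
Lemma sign_interpolation (F : realFieldType) (rs : seq F) (k : F)
    (w g : {poly F}) :
  uniq rs -> k != 0 -> w = k *: \prod_(s <- rs) ('X - s%:P) ->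
  (size g < size rs)%N ->
  (forall r, r \in rs -> g.[r] * w^`().[r] <= 0) -> g = 0.
Proof.
move=> rs_uniq k0 -> size_g sgn.
have sr := sum_residues rs_uniq size_g.
set v := \prod_(s <- rs) _ in sgn sr.
have v0 r : r \in rs -> v^`().[r] != 0.
  move=> r_in; rewrite horner_deriv_prod_XsubC // horner_prod_XsubC_neq0 //.
  by rewrite (rem_filter _ rs_uniq) mem_filter /= eqxx.
have term r : r \in rs -> 0 <= - k * (g.[r] / v^`().[r]).
  move=> r_in; have := sgn _ r_in; rewrite derivZ hornerZ => le0.
  have v2 : 0 < v^`().[r] ^+ 2 by rewrite exprn_even_gt0 //= v0.
  rewrite -(pmulr_lge0 _ v2) //.
  have -> : - k * (g.[r] / v^`().[r]) * v^`().[r] ^+ 2 =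
     - (g.[r] * (k * v^`().[r])) by field; rewrite v0.
  by rewrite oppr_ge0.
have sum0 : \sum_(r <- rs | r \in rs) - k * (g.[r] / v^`().[r]) = 0.
  by rewrite -big_seq -mulr_sumr sr mulr0.
apply: (roots_geq_poly_eq0 _ rs_uniq (ltnW size_g)); apply/allP => r r_in.
apply/rootP.
move/eqP: sum0; rewrite psumr_eq0 // => /allP/(_ _ r_in); rewrite r_in /=.
by rewrite !mulf_eq0 oppr_eq0 (negPf k0) invr_eq0 (negPf (v0 _ r_in)) orbF => /eqP.
Qed.

(** * Real-rooted polynomials *)

Local Notation prodX rs := (\prod_(r <- rs) ('X - r%:P)).

(* [P'^2 - P P'' = P^2 * \sum_r (x - r)^-2] off the roots. *)
Lemma laguerre_ineq (R : realDomainType) (rs : seq R) (x : R) :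
  let P := prodX rs in let L := P^`().[x] ^+ 2 - P.[x] * P^`()^`().[x] in
  0 <= L /\ ((0 < size rs)%N -> P.[x] != 0 -> 0 < L).
Proof.
elim: rs => [|r rs].
  by rewrite big_nil /= derivC deriv0 !hornerE expr0n subr0 lexx.
rewrite big_cons; set Q := prodX rs => /= - [IH _].
have -> : (('X - r%:P) * Q)^`().[x] ^+ 2
   - (('X - r%:P) * Q).[x] * (('X - r%:P) * Q)^`()^`().[x]
   = Q.[x] ^+ 2 + (x - r) ^+ 2 * (Q^`().[x] ^+ 2 - Q.[x] * Q^`()^`().[x]).
  by rewrite !derivM derivXsubC !mul1r !derivD derivM derivXsubC mul1r
    !(hornerXsubC, hornerD, hornerM); ring.
rewrite hornerM mulf_eq0 negb_or.
split; first exact: addr_ge0 (sqr_ge0 _) (mulr_ge0 (sqr_ge0 _) IH).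
move=> _ /andP[_ Q0]; apply: ltr_pwDl (mulr_ge0 (sqr_ge0 _) IH).
by rewrite exprn_even_gt0.
Qed.

(** Off the roots, [P P' = P^2 * \sum_r 1 / (x - r)], where every summand has the sign of [e]. *)
Lemma horner_mul_deriv_prodX (R : realDomainType) (rs : seq R) (e x : R) :
  e != 0 -> (forall r, r \in rs -> 0 <= e * (x - r)) ->
  let P := prodX rs in let L := e * (P.[x] * P^`().[x]) in
  0 <= L /\ ((0 < size rs)%N -> P.[x] != 0 -> 0 < L).
Proof.
move=> e0; elim: rs => [|r rs IH] er.
  by rewrite big_nil /= derivC horner0 !mulr0 lexx.
have /IH := fun s hs => er s (@mem_behead _ (r :: rs) s hs).
rewrite big_cons; set Q := prodX rs => /= - [{}IH _].
have -> : e * ((('X - r%:P) * Q).[x] * (('X - r%:P) * Q)^`().[x])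
   = (e * (x - r)) * Q.[x] ^+ 2 + (x - r) ^+ 2 * (e * (Q.[x] * Q^`().[x])).
  by rewrite !derivM derivXsubC !mul1r !(hornerXsubC, hornerD, hornerM); ring.
have er0 := er r (mem_head _ _).
rewrite hornerM mulf_eq0 negb_or hornerXsubC.
split.
  exact: addr_ge0 (mulr_ge0 er0 (sqr_ge0 _)) (mulr_ge0 (sqr_ge0 _) IH).
move=> _ /andP[xr Q0]; apply: ltr_pwDl (mulr_ge0 (sqr_ge0 _) IH).
by rewrite mulr_gt0 ?exprn_even_gt0 // lt_def er0 mulf_neq0.
Qed.

Lemma sign_prodX (R : realDomainType) (rs : seq R) (e x : R) :
  (forall r, r \in rs -> 0 <= e * (x - r)) -> 0 <= e ^+ size rs * (prodX rs).[x].
Proof.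
elim: rs => [|r rs IH] er; first by rewrite big_nil !hornerE.
rewrite big_cons hornerM hornerXsubC /= exprS mulrACA mulr_ge0 ?er ?mem_head //.
by apply: IH => s hs; rewrite er // in_cons hs orbT.
Qed.

Section RealRooted.
Variable R : rcfType.
Local Notation Re := (@complex.Re R).
Local Notation Im := (@complex.Im R).
Local Notation real_poly := (map_poly (real_complex R)).

(** The Gauss-Lucas computation: [P' / P = \sum_r 1 / (z - r)], and for real [r] each summand has
    imaginary part of sign opposite to [Im z]. *)
Lemma Im_deriv_mul_conj (rs : seq R) (z : R[i]) :
  let P := real_poly (prodX rs) in
  let L := Im z * Im (P^`().[z] * (P.[z])^*) in
  L <= 0 /\ ((0 < size rs)%N -> Im z != 0 -> P.[z] != 0 -> L < 0).
Proof.
elim: rs => [|r rs].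
  by rewrite big_nil /= rmorph1 derivC horner0 mul0r mulr0 lexx.
rewrite big_cons rmorphM /= rmorphB /= map_polyX map_polyC /=.
set Q := real_poly (prodX rs) => -[IH _].
have -> : Im z * Im ((('X - (r%:C)%:P) * Q)^`().[z] * ((('X - (r%:C)%:P) * Q).[z])^*)
  = - (Im z) ^+ 2 * (Re Q.[z] ^+ 2 + Im Q.[z] ^+ 2)
    + ((Re z - r) ^+ 2 + Im z ^+ 2) * (Im z * Im (Q^`().[z] * (Q.[z])^*)).
  rewrite derivM derivXsubC mul1r !(hornerXsubC, hornerD, hornerM).
  move: z {IH} => -[x y]; case: (Q.[_]) => a b; case: (Q^`().[_]) => a1 b1 /=; ring.
have z2 : 0 <= (Re z - r) ^+ 2 + Im z ^+ 2 by rewrite addr_ge0 ?sqr_ge0.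
have Q2 : 0 <= Re Q.[z] ^+ 2 + Im Q.[z] ^+ 2 by rewrite addr_ge0 ?sqr_ge0.
have IH' := mulr_ge0_le0 z2 IH; rewrite mulNr addrC subr_le0 subr_lt0.
split; first exact: le_trans IH' (mulr_ge0 (sqr_ge0 _) Q2).
move=> _ y0; rewrite hornerM mulf_eq0 negb_or => /andP[_ Q0].
apply: (le_lt_trans IH'); rewrite mulr_gt0 ?exprn_even_gt0 //.
by rewrite lt_def Q2 andbT paddr_eq0 ?sqr_ge0 // !sqrf_eq0 -(eq_complex _ 0).
Qed.

(** A nonreal root of [q'] is not a root of [q - e], so the strict inequality of [Im_deriv_mul_conj]
    applies there and is violated by [q' = 0]. *)
Lemma real_rooted_deriv (q : {poly R}) (k e : R) (rs : seq R) :
  (0 < size rs)%N -> k != 0 -> q - e%:P = k *: prodX rs ->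
  exists cs, q^`() = lead_coef q^`() *: prodX cs.
Proof.
move=> rs0 k0 qE.
have dqE : q^`() = k *: (prodX rs)^`() by rewrite -derivZ -qE derivB derivC subr0.
have [zs zsE] := closed_field_poly_normal (real_poly q^`()).
have q0 : q^`() != 0.
  rewrite dqE scaler_eq0 negb_or k0 -size_poly_eq0 size_deriv.
  by rewrite size_prod_XsubC /= -lt0n.
have zs_real z : z \in zs -> (Re z)%:C = z.
  move=> z_in; have z_root : root (real_poly q^`()) z.
    by rewrite zsE rootZ ?root_prod_XsubC // lead_coef_eq0 map_poly_eq0.
  have dP0 : (real_poly (prodX rs))^`().[z] = 0.
    move/rootP: z_root; rewrite dqE map_polyZ hornerZ -deriv_map => /eqP.
    by rewrite mulf_eq0 eq_complex /= (negPf k0) => /eqP.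
  apply/eqP; rewrite eq_complex eqxx /= eq_sym; apply/negP => /negP z0.
  have [P0|P0] := eqVneq (real_poly (prodX rs)).[z] 0.
    have : root (real_poly (prodX rs)) z by apply/rootP.
    rewrite rmorph_prod (eq_bigr (fun r => 'X - (r%:C)%:P)) => [|r _]; last first.
      by rewrite rmorphB /= map_polyX map_polyC.
    rewrite -(big_map (real_complex R) xpredT (fun r => 'X - r%:P)).
    by rewrite root_prod_XsubC => /mapP[r _ zr]; rewrite zr eqxx in z0.
  have [_ /(_ rs0 z0 P0)] := Im_deriv_mul_conj rs z.
  by rewrite dP0 mul0r mulr0 ltxx.
exists (map Re zs); apply: (map_inj_poly (@complexI R) (rmorph0 _)).
rewrite zsE map_polyZ lead_coef_map; congr (_ *: _).
rewrite rmorph_prod big_map; apply: eq_big_seq => z z_in.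
by rewrite rmorphB /= map_polyX map_polyC /= zs_real.
Qed.

End RealRooted.

Lemma mul_sign (R : realDomainType) (x y z : R) :
  0 <= x * y -> y * z < 0 -> x * z <= 0.
Proof.
move=> xy yz.
have y2 : 0 < y ^+ 2.
  by rewrite exprn_even_gt0 //=; apply: contraTneq yz => ->; rewrite mul0r ltxx.
have := mulr_ge0_le0 xy (ltW yz).
have -> : x * y * (y * z) = x * z * y ^+ 2 by ring.
by rewrite pmulr_lle0.
Qed.

Lemma horner_deriv_comparison (R : comNzRingType) (q t u : {poly R}) (a b x0 x : R) :
  ((q - a *: t) * (1 - x0 *: 'X) + b *: ((1 - 'X^2) * u))^`().[x]
  = (q^`().[x] - a * t^`().[x]) * (1 - x0 * x) - (q.[x] - a * t.[x]) * x0
    + b * ((1 - x ^+ 2) * u^`().[x] - x * u.[x] *+ 2).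
Proof.
rewrite -!mul_polyC !(derivM, derivD, derivN, derivC, derivX, derivXn).
by rewrite !(hornerXn, hornerMn, hornerX, hornerC, hornerN, hornerD, hornerM); ring.
Qed.

(** * Extremality of [T_d] when [q - 1] and [q + 1] are real-rooted *)

Section Extremal.
Variables (R : rcfType) (d : nat) (k : R) (q : {poly R}).
Hypothesis k0 : k != 0.
Hypothesis q_split : forall e : R, e ^+ 2 = 1 ->
  exists rs, [/\ size rs = d.+1, q - e%:P = k *: prodX rs
                 & forall r, r \in rs -> -1 <= r <= 1].

Let sqr1 : (1 : R) ^+ 2 = 1. Proof. by rewrite expr1n. Qed.
Let sqrN1 : (-1 : R) ^+ 2 = 1. Proof. by rewrite sqrrN expr1n. Qed.

Lemma sqr_eq1 (e : R) : e ^+ 2 = 1 -> e = 1 \/ e = -1.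
Proof. by move/eqP; rewrite sqrf_eq1 => /orP[] /eqP; [left | right]. Qed.

Lemma size_split : size q = d.+2.
Proof.
have [rs [size_rs qE _]] := q_split sqr1.
have -> : q = k *: prodX rs + 1%:P by rewrite -qE subrK.
by rewrite size_polyDl size_scale // size_prod_XsubC size_rs // size_polyC oner_eq0.
Qed.

Lemma split_shift e : e ^+ 2 = 1 -> exists rs, size rs = d.+1 /\
  forall x, q.[x] = e + k * (prodX rs).[x] /\
   [/\ q^`().[x] = k * (prodX rs)^`().[x],
       q^`()^`().[x] = k * (prodX rs)^`()^`().[x] &
       (forall r, r \in rs -> -1 <= r <= 1)].
Proof.
case/q_split=> rs [size_rs qE rs1]; exists rs; split=> // x.
have qE' : q = e%:P + k *: prodX rs by rewrite -qE addrC subrK.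
have q'E : q^`() = k *: (prodX rs)^`() by rewrite qE' derivD derivC derivZ add0r.
by rewrite q'E derivZ !hornerZ qE' hornerD hornerC hornerZ.
Qed.

(** At or beyond the end [e] all roots of [q - f] lie on one side of [x], which fixes the sign of
    the logarithmic derivative of [q - f]. *)
Lemma horner_deriv_end_gt0 (e x f : R) :
  e ^+ 2 = 1 -> 1 <= e * x -> f ^+ 2 = 1 -> q.[x] != f ->
  0 < e * ((q.[x] - f) * q^`().[x]).
Proof.
move=> e2 ex f2 qf; have [rs [size_rs /(_ x) [qE [q'E _ rs1]]]] := split_shift f2.
have e0 : e != 0 by rewrite -sqrf_eq0 e2 oner_eq0.
have er r : r \in rs -> 0 <= e * (x - r).
  by move=> /rs1; case: (sqr_eq1 e2) => eE; rewrite eE in ex *; lra.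
have [_] := horner_mul_deriv_prodX e0 er; rewrite size_rs => /(_ isT).
have P0 : (prodX rs).[x] != 0.
  by apply: contra_neq qf => P0; rewrite qE P0 mulr0 addr0.
move=> /(_ P0) L.
have k2 : 0 < k ^+ 2 by rewrite exprn_even_gt0.
by rewrite qE q'E; have := mulr_gt0 k2 L; congr (0 < _); ring.
Qed.

(** [q - 1] and [q + 1] share degree, leading coefficient and the side of [e] on which their roots
    lie, hence their sign at [e]; so [|q| >= 1] there. The sign of [q q'] comes from
    [horner_deriv_end_gt0] with [f] the unit of sign opposite to [q.[e]]. *)
Lemma end_values e : e ^+ 2 = 1 ->
  1 <= q.[e] ^+ 2 /\ 0 < e * (q.[e] * q^`().[e]).
Proof.
move=> e2.
have sgn f : f ^+ 2 = 1 -> 0 <= e ^+ d.+1 * (k * (q.[e] - f)).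
  move=> f2; have [rs [size_rs /(_ e) [qE [_ _ rs1]]]] := split_shift f2.
  have er r : r \in rs -> 0 <= e * (e - r).
    by move=> /rs1; case: (sqr_eq1 e2) => ->; lra.
  have k2 : 0 <= k ^+ 2 by rewrite sqr_ge0.
  rewrite qE; have := mulr_ge0 k2 (sign_prodX er).
  by rewrite size_rs; congr (0 <= _); ring.
have q2 : 1 <= q.[e] ^+ 2.
  have := mulr_ge0 (sgn 1 sqr1) (sgn (-1) sqrN1).
  rewrite mulrACA -expr2 -exprM mulnC exprM e2 expr1n mul1r.
  have -> : k * (q.[e] - 1) * (k * (q.[e] - -1)) = k ^+ 2 * (q.[e] ^+ 2 - 1).
    by ring.
  by rewrite pmulr_rge0 ?exprn_even_gt0 // subr_ge0.
split=> //.
have ee : 1 <= e * e by rewrite -expr2 e2.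
have [q0|q0] := leP 0 q.[e].
  have q1 : 1 <= q.[e] by nra.
  have := horner_deriv_end_gt0 e2 ee sqrN1 _.
  have -> : q.[e] != -1 by apply/eqP; lra.
  move=> /(_ isT); nra.
have q1 : q.[e] <= -1 by nra.
have := horner_deriv_end_gt0 e2 ee sqr1 _.
have -> : q.[e] != 1 by apply/eqP; lra.
move=> /(_ isT); nra.
Qed.

(** Laguerre's inequality for [q - f] gives [(q - f) q'' < 0] whenever [q.[c] != f]; a value
    strictly between [-1] and [1] would give [q''] both signs. Monotonicity beyond the ends keeps
    [c] inside. *)
Lemma critical_values c : q^`().[c] = 0 ->
  [/\ 1 <= q.[c] ^+ 2, q.[c] * q^`()^`().[c] < 0 & -1 < c < 1].
Proof.
move=> qc.
have conc f : f ^+ 2 = 1 -> q.[c] != f -> (q.[c] - f) * q^`()^`().[c] < 0.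
  move=> f2 qf; have [rs [size_rs /(_ c) [qE [q'E q''E _]]]] := split_shift f2.
  have P0 : (prodX rs).[c] != 0.
    by apply: contra_neq qf => P0; rewrite qE P0 mulr0 addr0.
  have [_] := laguerre_ineq rs c; rewrite size_rs => /(_ isT P0).
  have -> : (prodX rs)^`().[c] = 0.
    by move/eqP: qc; rewrite q'E mulf_eq0 (negPf k0) => /eqP.
  have k2 : 0 < k ^+ 2 by rewrite exprn_even_gt0.
  move/(mulr_gt0 k2); rewrite qE q''E -oppr_gt0; congr (0 < _); ring.
have inside e : e ^+ 2 = 1 -> e * c < 1.
  move=> e2; rewrite ltNge; apply/negP => ec.
  have gt0 f := @horner_deriv_end_gt0 e c f e2 ec.
  have [qc1|qc1] := eqVneq q.[c] 1.
    have /gt0 : (-1 : R) ^+ 2 = 1 by [].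
    have -> : q.[c] != -1 by rewrite qc1; apply/eqP; lra.
    by move=> /(_ isT); rewrite qc !mulr0 ltxx.
  by have := gt0 1 sqr1 qc1; rewrite qc !mulr0 ltxx.
have cint : -1 < c < 1.
  by have := inside 1 sqr1; have := inside _ sqrN1; rewrite mul1r mulN1r; lra.
have [qc1|qc1] := leP 1 q.[c].
  have := conc (-1) sqrN1; have -> : q.[c] != -1 by apply/eqP; lra.
  by move=> /(_ isT) ?; split=> //; nra.
have := conc 1 sqr1; have -> : q.[c] != 1 by apply/eqP; lra.
move=> /(_ isT) h.
have [qc2|qc2] := leP q.[c] (-1); first by split=> //; nra.
have := conc (-1) sqrN1; have -> : q.[c] != -1 by apply/eqP; lra.
by move=> /(_ isT) ?; exfalso; nra.
Qed.

(** The critical points are real by Gauss-Lucas, and simple because [q''] does not vanish at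
    them. *)
Lemma deriv_split : exists k' cs,
  [/\ k' != 0, q^`() = k' *: prodX cs, size cs = d, uniq cs
      & forall c, c \in cs -> q^`().[c] = 0].
Proof.
have [rs [size_rs qE _]] := q_split sqr1.
have [|cs csE] := real_rooted_deriv _ k0 qE; first by rewrite size_rs.
have q'0 : q^`() != 0 by rewrite -size_poly_eq0 size_deriv size_split.
have lc0 : lead_coef q^`() != 0 by rewrite lead_coef_eq0.
have csP c : c \in cs -> q^`().[c] = 0.
  by move=> c_in; apply/rootP; rewrite csE rootZ // root_prod_XsubC.
exists (lead_coef q^`()), cs; split=> //.
  have := congr1 (fun p : {poly R} => size p) csE.
  by rewrite size_scale // size_prod_XsubC size_deriv size_split => -[].
apply: count_mem_uniq => c; have [c_in|c_in] := boolP (c \in cs); last first.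
  by apply/count_memPn.
rewrite (permP (perm_to_rem c_in)) /= eqxx (_ : count_mem c _ = 0)%N //.
apply/count_memPn; have [_ qq _] := critical_values (csP _ c_in).
apply: contraTN qq => c_in'; rewrite csE derivZ hornerZ.
rewrite horner_deriv_prod_XsubC //.
have /rootP -> : root (prodX (rem c cs)) c by rewrite root_prod_XsubC.
by rewrite !mulr0 ltxx.
Qed.

(* Both extremality lemmas interpolate a difference of [q] and a Chebyshev
   comparison function at the critical points of [q], at [1], [-1], and at the
   contact point. *)
Lemma end_extremal e : e ^+ 2 = 1 -> q.[e] ^+ 2 = 1 ->
  `|q^`().[e]| <= (d.+1)%:R ^+ 2 ->
  q = chebyshevT R d.+1 \/ q = - chebyshevT R d.+1.
Proof.
move=> e2 qe2 q'e.
have [k' [cs [k'0 q'E size_cs cs_uniq csP]]] := deriv_split.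
(* [s] is the sign for which [s T] agrees with [q] at [e], since [T.[e] = e ^+ d.+1]. *)
set T := chebyshevT R d.+1; pose s := q.[e] * e ^+ d.+1.
have [Te Ue] := chebyshev_end d.+1 e2.
have ed2 : e ^+ d.+1 ^+ 2 = 1 by rewrite -exprM mulnC exprM e2 expr1n.
have s2 : s ^+ 2 = 1 by rewrite exprMn qe2 ed2 mulr1.
have sT : s * T.[e] = q.[e] by rewrite Te -mulrA -expr2 ed2 mulr1.
have /factor_theorem[g gE] : root (q - s *: T) e.
  by rewrite rootE hornerD hornerN hornerZ sT subrr.
have T1 x : x ^+ 2 <= 1 -> (s * T.[x]) ^+ 2 <= 1.
  move=> x1; rewrite exprMn s2 mul1r -(horner_chebyshev_pythagoras x d.+1).
  by rewrite lerDl mulr_ge0 ?sqr_ge0 // subr_ge0.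
suff g0 : g = 0.
  have qE : q = s *: T by apply/eqP; rewrite -subr_eq0 gE g0 mul0r.
  by case: (sqr_eq1 s2) => sE; [left | right]; rewrite qE sE ?scale1r ?scaleN1r.
(* The factor [e] treats both ends alike: [e (r^2 - 1) / (r - e) = 1 + e r] is positive inside the
   interval. *)
have eg0 : e *: g = 0.
  apply: (@sign_interpolation _ [:: 1, -1 & cs] k' (('X^2 - 1) * q^`())) => //.
  - rewrite /= in_cons negb_or cs_uniq !andbT -andbA; apply/and3P; split.
    + by apply/eqP; lra.
    + by apply/negP => /csP /critical_values[_ _]; rewrite ltxx andbF.
    + by apply/negP => /csP /critical_values[_ _]; rewrite ltxx.
  - rewrite q'E !big_cons -scalerAr; congr (_ *: _).
    by rewrite mulrA; congr (_ * _); rewrite polyCN; ring.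
  - rewrite size_scale /= ?size_cs; last by rewrite -sqrf_eq0 e2 oner_eq0.
    have [->|g0] := eqVneq g 0; first by rewrite size_poly0.
    have := size_Mmonic g0 (monicXsubC e); rewrite -gE size_XsubC addn2 /= => <-.
    rewrite (leq_trans (size_polyD _ _)) // geq_max size_split leqnn size_polyN.
    by rewrite (leq_trans (size_scale_leq _ _)) // size_chebyshevT.
  - move=> r r_in; rewrite derivM derivB derivXn derivC subr0 hornerZ.
    rewrite /= !(hornerXn, hornerMn, hornerX, hornerC, hornerN, hornerD, hornerM).
    have gr : q.[r] - s * T.[r] = g.[r] * (r - e).
      by rewrite -(hornerXsubC e r) -hornerM -gE !(hornerD, hornerN, hornerZ).
    have [r2|r2] := eqVneq (r ^+ 2) 1; last first.
      have r_cs : r \in cs.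
        move: r_in; rewrite !in_cons => /or3P[/eqP rE|/eqP rE|//].
          by rewrite rE expr1n eqxx in r2.
        by rewrite rE sqrrN expr1n eqxx in r2.
      (* At a critical node [|s T| <= 1 <= |q|], so [q - s T] has the sign of [q], opposite to that
         of [q'']. *)
      have [qr qq r1] := critical_values (csP _ r_cs).
      rewrite (csP _ r_cs) mulr0 add0r.
      have := T1 r _; have -> : r ^+ 2 <= 1 by nra.
      move=> /(_ isT) Tr.
      have pos : 0 < 1 + e * r by case: (sqr_eq1 e2) => ->; lra.
      have -> : e * g.[r] * ((r ^+ 2 - 1) * q^`()^`().[r])
        = (q.[r] - s * T.[r]) * q^`()^`().[r] * (1 + e * r).
        by rewrite gr; case: (sqr_eq1 e2) => ->; ring.
      rewrite pmulr_lle0 //; apply: mul_sign qq; nra.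
    rewrite r2 subrr mul0r addr0.
    have [rE|rE] : r = e \/ r = - e.
      by case: (sqr_eq1 r2) (sqr_eq1 e2) => -> [] ->; rewrite ?opprK; tauto.
      (* At the contact node [g] is the difference of derivatives, and the bound on [q'] enters:
         with [m = |q'(e)|] the product becomes [2 m (m - d.+1 ^ 2)]. *)
      have g'e : q^`().[e] - s * T^`().[e] = g.[e].
        have /(congr1 (fun p : {poly R} => p^`().[e])) := gE.
        rewrite derivB derivZ derivM derivXsubC mulr1 !hornerD hornerN hornerZ.
        by rewrite hornerM hornerXsubC subrr mulr0 add0r.
      have [_ m0] := end_values e2; set m := e * _ in m0.
      have mE : `|q^`().[e]| = m.
        have norm1 (x : R) : x ^+ 2 = 1 -> `|x| = 1.
          by move=> /sqr_eq1[] ->; rewrite ?normrN normr1.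
        by rewrite -(gtr0_norm m0) !normrM (norm1 _ e2) (norm1 _ qe2) !mul1r.
      have sT' : s * T^`().[e] = q.[e] * e * d.+1%:R ^+ 2.
        have UE : (chebyshevU R d.+1).[e] = e ^+ d.+1 *+ d.+1 * e.
          by rewrite -Ue -mulrA -expr2 e2 mulr1.
        have -> : q.[e] * e * d.+1%:R ^+ 2
          = (e ^+ d.+1) ^+ 2 * (q.[e] * e * d.+1%:R ^+ 2) by rewrite ed2 mul1r.
        by rewrite horner_deriv_chebyshevT UE /s; ring.
      rewrite rE -g'e sT'.
      have -> : e * (q^`().[e] - q.[e] * e * d.+1%:R ^+ 2) * (e *+ 2 * q^`().[e])
         = e ^+ 2 * (q^`().[e] ^+ 2 - m * d.+1%:R ^+ 2) *+ 2 by rewrite /m; ring.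
      rewrite e2 mul1r -(real_normK (num_real _)) mE.
      by rewrite mulrn_wle0 // expr2 -mulrBr mulr_ge0_le0 ?(ltW m0) // -mE subr_le0.
    (* At the opposite end [q - s T] again has the sign of [q], while [q] and [e q'] have opposite
       signs by [end_values]. *)
    have [q1 m0] := end_values r2.
    have := T1 r _; rewrite r2 lexx => /(_ isT) Tr.
    have -> : e * g.[r] * (r *+ 2 * q^`().[r])
      = (q.[r] - s * T.[r]) * (e * q^`().[r]) by rewrite gr rE; ring.
    apply: (@mul_sign _ _ q.[r]); first by nra.
    by rewrite mulrCA -oppr_gt0 -mulNr -rE.
by apply/eqP; move/eqP: eg0; rewrite scaler_eq0 -sqrf_eq0 e2 oner_eq0.
Qed.

(** The last hypothesis compares slopes: a function [S = cos (D t + s)] of [x = cos t], with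
    [D = d.+1], satisfies [(1 - x^2) S'^2 = D^2 (1 - S^2)]. *)
Lemma interior_extremal x0 : -1 < x0 < 1 -> q.[x0] ^+ 2 < 1 ->
  (1 - x0 ^+ 2) * q^`().[x0] ^+ 2 <= (d.+1)%:R ^+ 2 * (1 - q.[x0] ^+ 2) ->
  q = chebyshevT R d.+1 \/ q = - chebyshevT R d.+1.
Proof.
move=> x01 q01 q'01.
have [k' [cs [k'0 q'E size_cs cs_uniq csP]]] := deriv_split.
set T := chebyshevT R d.+1; set U := chebyshevU R d.+1.
have y0gt0 : 0 < 1 - x0 ^+ 2 by nra.
pose y0 := Num.sqrt (1 - x0 ^+ 2).
have y02 : y0 ^+ 2 = 1 - x0 ^+ 2 by rewrite sqr_sqrtr // ltW.
(* With [x0 = cos t0], [q.[x0]] and [s0] are the cosine and sine of [D t0 + s]; the sign of [s0]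
   makes the slope of the comparison function agree in sign with [q']. *)
pose s0 := Num.sg q^`().[x0] * Num.sqrt (1 - q.[x0] ^+ 2).
have q'0 : q^`().[x0] != 0.
  apply/eqP => /critical_values[]; nra.
have s02 : s0 ^+ 2 = 1 - q.[x0] ^+ 2.
  by rewrite exprMn sqr_sg q'0 mul1r sqr_sqrtr // subr_ge0 ltW.
have s0q' : y0 * q^`().[x0] ^+ 2 <= d.+1%:R * (s0 * q^`().[x0]).
  have le : y0 * `|q^`().[x0]| <= d.+1%:R * Num.sqrt (1 - q.[x0] ^+ 2).
    rewrite -ler_sqr ?nnegrE ?mulr_ge0 ?sqrtr_ge0 //.
    by rewrite !exprMn y02 real_normK ?num_real // sqr_sqrtr // subr_ge0 ltW.
  have := ler_wpM2r (normr_ge0 q^`().[x0]) le.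
  have -> : d.+1%:R * Num.sqrt (1 - q.[x0] ^+ 2) * `|q^`().[x0]|
    = d.+1%:R * (s0 * q^`().[x0]) by rewrite normrEsg /s0; ring.
  by rewrite -mulrA -expr2 real_normK ?num_real.
(* [C] and [S] are the cosine and sine of [D t0]; [a] and [b], those of the phase [s], come from the
   subtraction formulas. *)
pose C := T.[x0]; pose S := y0 * U.[x0].
have CS : C ^+ 2 + S ^+ 2 = 1.
  by rewrite exprMn y02; apply: horner_chebyshev_pythagoras.
pose a := C * q.[x0] + S * s0; pose b := C * s0 - S * q.[x0].
have ab : a ^+ 2 + b ^+ 2 = 1.
  have -> : a ^+ 2 + b ^+ 2 = (C ^+ 2 + S ^+ 2) * (q.[x0] ^+ 2 + s0 ^+ 2).
    by rewrite /a /b; ring.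
  by rewrite CS mul1r s02 addrC subrK.
(* With [y = sin t], the comparison function is [a T - b y U], and
   [1 - cos (t - t0) = 1 - x x0 - y y0]. Extending the quotient by [1 - x x0 + y y0] turns the
   denominator into [(x - x0)^2]; [n] is the part of the numerator even in [t]. *)
pose n := (q - a *: T) * (1 - x0 *: 'X) + (b * y0) *: ((1 - 'X^2) * U).
have nE x : n.[x] = (q.[x] - a * T.[x]) * (1 - x0 * x)
   + b * y0 * ((1 - x ^+ 2) * U.[x]).
  rewrite /n -!mul_polyC.
  by rewrite !(hornerXn, hornerX, hornerC, hornerN, hornerD, hornerM).
have aC : q.[x0] - a * C + b * S = 0.
  have -> : q.[x0] - a * C + b * S = (1 - (C ^+ 2 + S ^+ 2)) * q.[x0].
    by rewrite /a /b; ring.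
  by rewrite CS subrr mul0r.
have bC : a * S + b * C = s0.
  have -> : a * S + b * C = (C ^+ 2 + S ^+ 2) * s0 by rewrite /a /b; ring.
  by rewrite CS mul1r.
have n0 : n.[x0] = 0.
  rewrite nE -/C -expr2 -y02 -[RHS](mulr0 (y0 ^+ 2)) -aC /S; ring.
(* This is [y0^2] times the difference of slopes, the comparison function having slope [D s0 / y0]
   at [x0]. *)
have n'0 : n^`().[x0] = y0 ^+ 2 * q^`().[x0] - d.+1%:R * y0 * s0.
  have U' := horner_deriv_chebyshevU x0 d.+1.
  rewrite -/U -/T in U'.
  rewrite horner_deriv_comparison -/n.
  have -> : (1 - x0 ^+ 2) * U^`().[x0] - x0 * U.[x0] *+ 2 = - x0 * U.[x0] - C *+ d.+1.
    by rewrite U' -/C; ring.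
  rewrite horner_deriv_chebyshevT -/C -/T -/U -bC.
  have -> : q.[x0] = a * C - b * S by rewrite -[RHS]addr0 -aC; ring.
  rewrite -expr2 -y02 /S; ring.
(* [n = q u - (a V - b Y)] with [(a, b)] a unit vector and [V^2 + Y^2 <= u^2], so Cauchy-Schwarz
   bounds the subtracted term by [u <= |q| u]. *)
have n_sgn x : x ^+ 2 <= 1 -> 1 <= q.[x] ^+ 2 -> 0 <= n.[x] * q.[x].
  move=> x1 q1; have u0 : 0 < 1 - x0 * x by nra.
  set u := 1 - x0 * x in u0; pose V := T.[x] * u; pose Y := y0 * ((1 - x ^+ 2) * U.[x]).
  have VY : V ^+ 2 + Y ^+ 2 <= u ^+ 2.
    rewrite -subr_ge0.
    have -> : u ^+ 2 - (V ^+ 2 + Y ^+ 2) = (1 - x ^+ 2) * U.[x] ^+ 2 * (x - x0) ^+ 2.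
      have TU : 1 - T.[x] ^+ 2 = (1 - x ^+ 2) * U.[x] ^+ 2.
        by rewrite -[X in X - _](horner_chebyshev_pythagoras x d.+1) addrC addKr.
      have -> : u ^+ 2 - (V ^+ 2 + Y ^+ 2)
        = u ^+ 2 * (1 - T.[x] ^+ 2) - (1 - x ^+ 2) ^+ 2 * U.[x] ^+ 2 * y0 ^+ 2.
        by rewrite /V /Y; ring.
      by rewrite TU y02 /u; ring.
    by rewrite (mulr_ge0 (mulr_ge0 _ (sqr_ge0 _)) (sqr_ge0 _)) // subr_ge0.
  have aVY : (a * V - b * Y) ^+ 2 <= u ^+ 2.
    have -> : (a * V - b * Y) ^+ 2
       = (a ^+ 2 + b ^+ 2) * (V ^+ 2 + Y ^+ 2) - (a * Y + b * V) ^+ 2 by ring.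
    by rewrite ab mul1r; have := sqr_ge0 (a * Y + b * V); lra.
  have qu : u ^+ 2 <= (q.[x] * u) ^+ 2.
    by rewrite exprMn ler_peMl ?sqr_ge0.
  have nE' : n.[x] = q.[x] * u - (a * V - b * Y) by rewrite nE -/u /V /Y; ring.
  rewrite -(pmulr_lge0 _ u0) nE'.
  have := sqr_ge0 (q.[x] * u - (a * V - b * Y)); nra.
have /factor_theorem[g gE] : root n x0 by apply/rootP.
suff g0 : g = 0.
  have n_eq0 x : n.[x] = 0 by rewrite gE g0 mul0r horner0.
  (* As [|q.[1]| >= 1] and [a^2 + b^2 = 1], this forces [b = 0]: the phase is trivial. *)
  have a1 : q.[1] = a.
    have := n_eq0 1; rewrite nE sqr1 subrr mul0r mulr0 addr0 => /eqP.
    rewrite (chebyshev_end d.+1 sqr1).1 expr1n !mulr1 mulf_eq0 => /orP[] /eqP; lra.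
  have [q1 _] := end_values sqr1; rewrite a1 in q1.
  have b0 : b = 0 by nra.
  have a2 : a ^+ 2 = 1 by rewrite -ab b0 expr0n addr0.
  have qE : q = a *: T.
    apply/eqP; rewrite -subr_eq0.
    have : n == 0 by rewrite gE g0 mul0r.
    rewrite /n b0 mul0r scale0r addr0 mulf_eq0 => /orP[//|/eqP xE].
    have := congr1 (horner^~ x0) xE.
    by rewrite !(horner0, hornerZ, hornerX, hornerC, hornerN, hornerD); nra.
  by case: (sqr_eq1 a2) => aE; [left | right]; rewrite qE aE ?scale1r ?scaleN1r.
have n'g : n^`().[x0] = g.[x0].
  by rewrite gE derivM derivXsubC mulr1 hornerD hornerM hornerXsubC subrr mulr0 add0r.
(* One factor [x - x0] of the denominator [(x - x0)^2] cancels against [n = g (x - x0)]; the other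
   makes [x0] a simple node. *)
apply: (@sign_interpolation _ [:: x0, 1, -1 & cs] (- k')
          (('X - x0%:P) * (1 - 'X^2) * q^`())) => //.
- rewrite /= !in_cons !negb_or cs_uniq !andbT -!andbA.
  do !(apply/andP; split); try by apply/eqP; lra.
  + by apply/negP => /csP /critical_values[]; lra.
  + by apply/negP => /csP /critical_values[_ _]; rewrite ltxx andbF.
  + by apply/negP => /csP /critical_values[_ _]; rewrite ltxx.
- by rewrite oppr_eq0.
- rewrite q'E !big_cons -scalerAr scaleNr -scalerN; congr (_ *: _).
  by rewrite !mulrA -!mulNr; congr (_ * _); rewrite polyCN; ring.
- have [->|g1] := eqVneq g 0; first by rewrite size_poly0.
  have := size_Mmonic g1 (monicXsubC x0).
  rewrite -gE size_XsubC addn2 /= size_cs => <-.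
  have sz2 : (size (1 - x0 *: 'X)%R <= 2)%N.
    rewrite (leq_trans (size_polyD _ _)) // geq_max size_poly1 size_polyN.
    by rewrite (leq_trans (size_scale_leq _ _)) // size_polyX.
  have sz3 : (size (1 - 'X^2 : {poly R})%R <= 3)%N.
    rewrite (leq_trans (size_polyD _ _)) // geq_max size_poly1 size_polyN.
    by rewrite size_polyXn.
  have szT : (size (q - a *: T)%R <= d.+2)%N.
    rewrite (leq_trans (size_polyD _ _)) // geq_max size_split leqnn size_polyN.
    by rewrite (leq_trans (size_scale_leq _ _)) // size_chebyshevT.
  have [szU _] := size_chebyshevU R d.+1.
  rewrite (leq_trans (size_polyD _ _)) // geq_max; apply/andP; split.
    rewrite (leq_trans (size_polyMleq _ _)) //.
    by have := leq_add szT sz2; rewrite addn2; case: (_ + _)%N.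
  rewrite (leq_trans (size_scale_leq _ _)) // (leq_trans (size_polyMleq _ _)) //.
  by have := leq_add sz3 szU; case: (_ + _)%N.
move=> r r_in.
have -> : (('X - x0%:P) * (1 - 'X^2) * q^`())^`().[r]
  = (1 - r ^+ 2 - (r - x0) * r *+ 2) * q^`().[r]
    + (r - x0) * (1 - r ^+ 2) * q^`()^`().[r].
  rewrite !(derivM, derivD, derivN, derivC, derivX, derivXn).
  rewrite !(hornerXn, hornerMn, hornerX, hornerC, hornerN, hornerD, hornerM); ring.
have gr : n.[r] = g.[r] * (r - x0) by rewrite gE hornerM hornerXsubC.
have [-> | r0] := eqVneq r x0.
  rewrite subrr !mul0r mul0rn subr0 addr0 -n'g n'0 -y02.
  have -> : (y0 ^+ 2 * q^`().[x0] - d.+1%:R * y0 * s0) * (y0 ^+ 2 * q^`().[x0])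
    = y0 ^+ 3 * (y0 * q^`().[x0] ^+ 2 - d.+1%:R * (s0 * q^`().[x0])) by ring.
  by rewrite mulr_ge0_le0 ?exprn_ge0 ?sqrtr_ge0 // subr_le0.
have [r2|r2] := eqVneq (r ^+ 2) 1.
  have [q1 m0] := end_values r2.
  have n1 := n_sgn r; rewrite r2 lexx in n1; have {}n1 := n1 isT q1.
  rewrite r2 subrr mulr0 mul0r addr0 sub0r.
  have -> : g.[r] * (- ((r - x0) * r *+ 2) * q^`().[r])
    = - (n.[r] * (r * q^`().[r])) *+ 2 by rewrite gr; ring.
  rewrite mulrn_wle0 // -mulrN.
  apply: (mul_sign n1); by rewrite mulrN mulrCA oppr_lt0.
have r_cs : r \in cs.
  move: r_in; rewrite !in_cons (negPf r0) /= => /or3P[/eqP rE|/eqP rE|//].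
    by rewrite rE expr1n eqxx in r2.
  by rewrite rE sqrrN expr1n eqxx in r2.
have [qr qq r1] := critical_values (csP _ r_cs).
rewrite (csP _ r_cs) mulr0 add0r.
have -> : g.[r] * ((r - x0) * (1 - r ^+ 2) * q^`()^`().[r])
  = n.[r] * q^`()^`().[r] * (1 - r ^+ 2) by rewrite gr; ring.
have r_lt1 : r ^+ 2 < 1 by nra.
by rewrite pmulr_lle0 ?subr_gt0 //; apply: mul_sign qq; apply: n_sgn => //; apply: ltW.
Qed.

End Extremal.

(** * The filled Julia set *)

Section ComplexModulus.
Variable R : realType.
Implicit Types z w : R[i].

Lemma cmodD z w : cmod (z + w) <= cmod z + cmod w.
Proof. exact: (@le_normcD R z w). Qed.

Lemma cmodN z : cmod (- z) = cmod z.
Proof. exact: (@normcN R z). Qed.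

Lemma cmodM z w : cmod (z * w) = cmod z * cmod w.
Proof. exact: ComplexField.Normc.normcM. Qed.

Lemma cmodX z n : cmod (z ^+ n) = cmod z ^+ n.
Proof.
elim: n => [|n IH]; first exact: ComplexField.Normc.normc1.
by rewrite !exprS cmodM IH.
Qed.

Lemma cmod_ge0 z : 0 <= cmod z.
Proof. by case: z => x y; apply: sqrtr_ge0. Qed.

Lemma cmod0 : cmod (0 : R[i]) = 0.
Proof. exact: ComplexField.Normc.normc0. Qed.

Lemma cmod_eq0 z : (cmod z == 0) = (z == 0).
Proof.
by apply/eqP/eqP => [/ComplexField.Normc.eq0_normc //|->]; rewrite cmod0.
Qed.

Lemma cmod_gt0 z : (0 < cmod z) = (z != 0).
Proof. by rewrite lt_def cmod_ge0 andbT cmod_eq0. Qed.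

Lemma cmodC z w : cmod (z - w) = cmod (w - z).
Proof. by rewrite -cmodN opprB. Qed.

Lemma cmodB z w : cmod z - cmod w <= cmod (z - w).
Proof. by rewrite lerBlDr (le_trans _ (cmodD _ _)) // subrK. Qed.

Lemma cmod_real (x : R) : cmod x%:C = `|x|.
Proof. by rewrite /= expr0n addr0 sqrtr_sqr. Qed.

Lemma cmod_sum (I : Type) (s : seq I) (F : I -> R[i]) :
  cmod (\sum_(i <- s) F i) <= \sum_(i <- s) cmod (F i).
Proof.
elim: s => [|i s IH]; first by rewrite !big_nil cmod0.
by rewrite !big_cons (le_trans (cmodD _ _)) // lerD2l.
Qed.

Lemma sqrt1D_ge1 (x : R) : 1 <= Num.sqrt (1 + x ^+ 2).
Proof. by rewrite -[leLHS]sqrtr1 ler_wsqrtr // lerDl sqr_ge0. Qed.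

Lemma sqrt1D_ge (x : R) : x <= Num.sqrt (1 + x ^+ 2).
Proof.
by rewrite (le_trans (ler_norm x)) // -sqrtr_sqr ler_wsqrtr // lerDr.
Qed.

Lemma sqrt1D_le (x y : R) : 0 <= x -> x <= y -> Num.sqrt (1 + x ^+ 2) <= 1 + y.
Proof.
move=> x0 xy; have y0 : 0 <= 1 + y by lra.
have -> : 1 + y = Num.sqrt ((1 + y) ^+ 2) by rewrite sqrtr_sqr ger0_norm.
by rewrite ler_wsqrtr //; nra.
Qed.

Lemma chordal_le z w : chordal z w <= 2 * cmod (z - w).
Proof.
have z1 := sqrt1D_ge1 (cmod z); have w1 := sqrt1D_ge1 (cmod w).
rewrite /chordal ler_pdivrMr; last by nra.
by rewrite ler_peMr ?mulr_ge0 ?cmod_ge0 //; nra.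
Qed.

(** Both points are near infinity: [|z - w| <= a + b] for the two square roots [a, b >= M], so the
    distance is at most [2 / a + 2 / b]. *)
Lemma chordal_far z w M : 0 < M -> M <= cmod z -> M <= cmod w ->
  chordal z w <= 4 / M.
Proof.
move=> M0 Mz Mw; have z1 := sqrt1D_ge (cmod z); have w1 := sqrt1D_ge (cmod w).
rewrite /chordal ler_pdivrMr; last by rewrite mulr_gt0 //; lra.
rewrite mulrAC ler_pdivlMr //.
have := cmodD z (- w); rewrite cmodN.
set a := Num.sqrt _ in z1 *; set b := Num.sqrt _ in w1 * => h.
have : M * a <= a * b by rewrite mulrC ler_pM2l; lra.
have : M * b <= a * b by rewrite ler_pM2r; lra.
nra.
Qed.

(* The chordal distance from [w] to [w'] is at least [2 e / (sqrt (1 + |w|^2) (1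
   + |w| + e))] with [e = |w - w'|], which increases with [e]. *)
Lemma chordal_small w eps : 0 < eps -> exists2 delta, 0 < delta &
  forall w', chordal w w' < delta -> cmod (w' - w) < eps.
Proof.
move=> eps0; set m := cmod w; have m0 : 0 <= m := cmod_ge0 w.
set a := Num.sqrt (1 + m ^+ 2); have a1 : 1 <= a := sqrt1D_ge1 m.
exists (2 * eps / (a * (1 + m + eps))).
  by rewrite divr_gt0 ?mulr_gt0 //; lra.
move=> w'; apply: contraTT; rewrite -!leNgt cmodC; set e := cmod (w - w') => ee.
rewrite /chordal -/e -/m -/a.
have w'm : cmod w' <= m + e.
  by have := cmodB w' w; rewrite cmodC -/e -/m; lra.
have := sqrt1D_le (cmod_ge0 w') w'm; have := sqrt1D_ge1 (cmod w').
set b := Num.sqrt _ => b1 bm.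
rewrite ler_pdivrMr; last by rewrite mulr_gt0 //; lra.
rewrite mulrAC ler_pdivlMr; last by rewrite mulr_gt0 //; lra.
have : eps * b <= e * (1 + m + eps) by nra.
have a0 : 0 <= 2 * a by lra.
move/(ler_wpM2l a0); lra.
Qed.

Lemma chordal_separated z w rho : 1 <= rho -> cmod z <= rho -> 2 * rho <= cmod w ->
  (2 * (1 + rho))^-1 <= chordal z w.
Proof.
move=> rho1 zr wr.
have := cmodB w z; rewrite cmodC => h.
have := sqrt1D_le (cmod_ge0 z) zr; have := sqrt1D_ge1 (cmod z).
have := sqrt1D_le (cmod_ge0 w) (lexx _); have := sqrt1D_ge1 (cmod w).
rewrite /chordal; set b := Num.sqrt _ => b1 b2; set a := Num.sqrt _ => a1 a2.
rewrite -[leLHS]mul1r ler_pdivrMr; last lra.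
rewrite mulrAC ler_pdivlMr; last nra.
rewrite mul1r.
have : a * b <= (1 + rho) * (1 + cmod w) by apply: ler_pM; lra.
have h0 : 0 <= 1 + rho by lra.
have : 1 + cmod w <= 4 * cmod (z - w) by lra.
move/(ler_wpM2l h0); lra.
Qed.

End ComplexModulus.

(** * Escape, equicontinuity and the equality [J = K] *)

Section FilledJulia.
Variables (R : realType) (p : {poly R[i]}).
Local Notation f := (horner p).
Implicit Types z w : R[i].

Lemma horner_lipschitz (q : {poly R[i]}) z : exists2 M, 0 <= M &
  forall w, cmod (w - z) <= 1 -> cmod (q.[w] - q.[z]) <= M * cmod (w - z).
Proof.
elim/poly_ind: q => [|q c [M M0 IH]].
  by exists 0 => // w _; rewrite !horner0 subrr cmod0 mul0r.
exists ((cmod z + 1) * M + cmod q.[z]).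
  by rewrite addr_ge0 ?mulr_ge0 ?addr_ge0 ?cmod_ge0.
move=> w wz; rewrite !hornerMXaddC.
have -> : q.[w] * w + c - (q.[z] * z + c) = w * (q.[w] - q.[z]) + q.[z] * (w - z).
  by ring.
rewrite (le_trans (cmodD _ _)) // !cmodM mulrDl lerD2r -mulrA.
have : cmod w <= cmod z + 1 by have := cmodB w z; lra.
by move=> h; apply: ler_pM; rewrite ?cmod_ge0 // IH.
Qed.

Lemma iter_continuous z N eps : 0 < eps -> exists2 delta, 0 < delta &
  forall w n, (n <= N)%N -> cmod (w - z) < delta ->
    cmod (iter n f w - iter n f z) < eps.
Proof.
elim: N eps => [|N IH] eps eps0.
  by exists eps => // w n; rewrite leqn0 => /eqP ->.
have [M M0 lip] := horner_lipschitz p (iter N f z).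
(* [1] keeps the iterate in the range of the Lipschitz bound, [eps] serves the earlier iterates, and
   [M + 1] avoids division by zero. *)
have e0 : 0 < Num.min 1 (Num.min eps (eps / (M + 1))).
  by rewrite !lt_min ltr01 eps0 divr_gt0 // ltr_wpDl.
have [delta delta0 IHd] := IH _ e0; exists delta => // w n nN wz.
have wn m : (m <= N)%N -> _ := fun mN => IHd w m mN wz.
move: nN; rewrite leq_eqVlt ltnS => /orP[/eqP -> /=|/wn]; last first.
  by rewrite !lt_min => /and3P[].
have := wn N (leqnn _); rewrite !lt_min => /and3P[w1 _ we].
apply: le_lt_trans (lip _ (ltW w1)) _.
have M1 : 0 < M + 1 by lra.
move: we; rewrite ltr_pdivlMr //.
by have := cmod_ge0 (iter N f w - iter N f z); nra.
Qed.

Variable rho : R.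
Hypothesis rho_ge1 : 1 <= rho.
Hypothesis escape : forall z, rho <= cmod z -> 2 * cmod z <= cmod p.[z].

(** Under [escape] an orbit that leaves the disc of radius [rho] tends to infinity, so this is the
    usual set of points with bounded orbit. *)
Definition filled : set R[i] := [set z | forall n, cmod (iter n f z) <= rho].

Lemma escape_iter z n : rho <= cmod z -> 2 ^+ n * cmod z <= cmod (iter n f z).
Proof.
move=> rz; elim: n => [|n IH]; first by rewrite mul1r.
have : rho <= cmod (iter n f z).
  have : 1 <= 2 ^+ n :> R by rewrite exprn_ege1 // ler1n.
  by move: (cmod_ge0 z) => z0 h; apply: le_trans IH; nra.
by move/escape; rewrite iterS exprS -mulrA; lra.
Qed.

Lemma filled_horner z : filled p.[z] <-> filled z.
Proof.
split=> hz n; last by rewrite -iterSr; apply: hz.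
rewrite leNgt; apply/negP => rn.
have := hz n; rewrite -iterSr iterS leNgt => /negP; apply.
by have rho1 := rho_ge1; apply: lt_le_trans (escape (ltW rn)); lra.
Qed.

Lemma not_filled z : ~ filled z -> exists N, rho < cmod (iter N f z).
Proof.
by move/existsNP => [N /negP hN]; exists N; rewrite ltNge.
Qed.

Lemma escape_open z N : rho < cmod (iter N f z) -> exists2 r, 0 < r &
  forall w, cmod (w - z) < r -> rho < cmod (iter N f w).
Proof.
rewrite -subr_gt0 => /(iter_continuous z N)[r r0 h].
exists r => // w /(h w N (leqnn _)).
by have := cmodB (iter N f z) (iter N f w); rewrite cmodC; lra.
Qed.

Lemma exp2_unbounded (x : R) : exists k, x <= 2 ^+ k.
Proof.
have [k hk] : exists k : nat, x <= k%:R.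
  by exists (Num.bound `|x|); rewrite (le_trans (ler_norm x)) // ltW // archi_boundP.
by exists k; rewrite (le_trans hk) // -natrX ler_nat ltnW // ltn_expl.
Qed.

(** Continuity handles the first [N + k] iterates; afterwards both orbits have modulus at least
    [2 ^ k] and are chordally within [4 / 2 ^ k < eps]. *)
Lemma escape_equicontinuous z N : rho < cmod (iter N f z) ->
  iterates_equicontinuous_at p z.
Proof.
move=> zN eps eps0; have [r r0 rN] := escape_open zN.
have [k hk] := exp2_unbounded (5 / eps).
have [r' r'0 h] : exists2 r', 0 < r' & forall w n, (n <= N + k)%N ->
    cmod (w - z) < r' -> cmod (iter n f w - iter n f z) < eps / 2.
  by apply: iter_continuous; lra.
have m0 : 0 < Num.min r r' by rewrite lt_min r0.
have [delta delta0 hd] := chordal_small z m0.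
exists delta => // w n /hd; rewrite lt_min => /andP[wr wr'].
have [nNk|nNk] := leqP n (N + k).
  apply: le_lt_trans (chordal_le _ _) _; rewrite cmodC.
  by have := h w n nNk wr'; lra.
have far v : rho < cmod (iter N f v) -> 2 ^+ k <= cmod (iter n f v).
  move=> vN; have Nn : (N <= n)%N by rewrite (leq_trans _ (ltnW nNk)) ?leq_addr.
  have kn : (k <= n - N)%N by rewrite leq_subRL // ltnW.
  rewrite -(subnK Nn) iterD; apply: le_trans (escape_iter (n - N) (ltW vN)).
  have -> : 2 ^+ k = 2 ^+ k * 1 :> R by rewrite mulr1.
  apply: ler_pM; rewrite ?exprn_ge0 // ?ler_weXn2l ?ler1n //.
  by apply: le_trans (ltW vN).
have k0 : 0 < 2 ^+ k :> R by rewrite exprn_gt0.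
apply: le_lt_trans (chordal_far k0 (far _ zN) (far _ (rN _ wr))) _.
rewrite ltr_pdivrMr // -ltr_pdivrMl // mulrC; apply: lt_le_trans hk.
by rewrite ltr_pM2r ?invr_gt0 // ltr_nat.
Qed.

Lemma not_filled_fatou z : ~ filled z -> fatou p z.
Proof.
move=> /not_filled[N zN]; have [r r0 rN] := escape_open zN; exists r => // w /rN.
exact: escape_equicontinuous.
Qed.

(** If a nearby orbit escapes, at some time it lies beyond [2 rho] while that of [z] stays within
    [rho]; [chordal_separated] bounds this gap below, against equicontinuity. *)
Lemma equicontinuous_filled z : filled z -> iterates_equicontinuous_at p z ->
  exists2 r, 0 < r & forall w, cmod (w - z) < r -> filled w.
Proof.
move=> zK; have rho1 := rho_ge1.
have e0 : 0 < (2 * (1 + rho))^-1 by rewrite invr_gt0; lra.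
move=> /(_ _ e0)[delta delta0 hd]; exists (delta / 2); first by lra.
move=> w wz; apply: contrapT => /not_filled[N wN].
have : chordal z w < delta.
  by apply: le_lt_trans (chordal_le _ _) _; rewrite cmodC; lra.
move=> /hd - /(_ N.+1).
rewrite ltNge (chordal_separated rho_ge1 (zK N.+1)) //.
by apply: le_trans (escape (ltW wN)); rewrite ler_pM2l // ltW.
Qed.

Lemma julia_filled : julia p `<=` [set x%:C | x in [set: R]] -> julia p = filled.
Proof.
move=> real.
have nonreal z : complex.Im z != 0 -> iterates_equicontinuous_at p z.
  move=> z0; have : fatou p z.
    apply: contrapT => zJ; have /real[x _ xz] : julia p z by [].
    by rewrite -xz eqxx in z0.
  by case=> r r0; apply; rewrite subrr cmod0.
have real_filled z : filled z -> complex.Im z = 0.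
  case: z => x y zK; apply/eqP; apply/negP => /negP /= y0.
  have ny0 : 0 < `|y| by rewrite normr_gt0.
  (* The vertical ray through [z], which is reached at [t = 1]; [A] is bounded since [K] is. *)
  pose ray t := Complex x (y * t) : R[i].
  pose A := [set t | filled (ray t)].
  have rayB t t' : cmod (ray t - ray t') = `|y| * `|t - t'|.
    by rewrite /= subrr expr0n add0r sqrtr_sqr -mulrBr normrM.
  have supA : has_sup A.
    split; first by exists 1; rewrite /A /= /ray mulr1.
    exists (rho / `|y|) => t /(_ 0%N) /= At; rewrite ler_pdivlMr //.
    apply: le_trans At; apply: (@le_trans _ _ `|y * t|).
      by rewrite normrM mulrC ler_wpM2l ?ler_norm.
    by rewrite -sqrtr_sqr ler_wsqrtr // lerDr sqr_ge0.
  have A1 : A 1 by rewrite /A /= /ray mulr1.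
  have T1 : 1 <= sup A by apply: sup_upper_bound.
  have AT : A (sup A).
    apply: contrapT => /not_filled[N /escape_open[r r0 rN]].
    have [|t At tT] := @sup_adherent _ A (r / `|y|) _ supA; first by rewrite divr_gt0.
    have tT' : t <= sup A by apply: sup_upper_bound.
    have /rN : cmod (ray t - ray (sup A)) < r.
      by rewrite rayB mulrC -ltr_pdivlMr // distrC ger0_norm ?subr_ge0 //; lra.
    by rewrite ltNge => /negP; apply; apply: At.
  (* The last point of [K] on the ray is nonreal, so [K] is open there and continues past it. *)
  have [|r r0 hr] := equicontinuous_filled AT.
    by apply: nonreal; rewrite /= mulf_neq0 //; apply/eqP; lra.
  have d0 : 0 < r / 2 / `|y| by rewrite divr_gt0 //; lra.
  have /hr : cmod (ray (sup A + r / 2 / `|y|) - ray (sup A)) < r.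
    rewrite rayB addrAC subrr add0r (ger0_norm (ltW d0)) mulrC divfK; first lra.
    by rewrite normr_eq0.
  by move=> /(sup_upper_bound supA); rewrite gerDl leNgt d0.
apply/seteqP; split=> z; first by move=> zJ; apply: contrapT => /not_filled_fatou.
(* A point of [K] in the Fatou set would have nonreal neighbours in [K]. *)
move=> zK [r r0 hr].
have [|r' r'0 hr'] := equicontinuous_filled zK.
  by apply: hr; rewrite subrr cmod0.
pose w := z + Complex 0 (r' / 2).
have /hr'/real_filled : cmod (w - z) < r'.
  by rewrite /w addrAC subrr add0r /= expr0n add0r sqrtr_sqr ger0_norm; lra.
by have := real_filled _ zK; rewrite /w; case: (z) => x y /= ->; lra.
Qed.

End FilledJulia.

Lemma escape_radius (R : realType) (p : {poly R[i]}) : (2 < size p)%N ->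
  exists2 rho, 1 <= rho & forall z, rho <= cmod z -> 2 * cmod z <= cmod p.[z].
Proof.
move=> size_p; have [d size_pE] : exists d, size p = d.+3.
  by move: size_p; case: (size p) => [|[|[|d]]] //; exists d.
pose c := cmod (lead_coef p); pose S := \sum_(i < d.+2) cmod p`_i.
have c0 : 0 < c by rewrite cmod_gt0 lead_coef_eq0 -size_poly_eq0 size_pE.
have S0 : 0 <= S by apply: sumr_ge0 => i _; apply: cmod_ge0.
(* Beyond this radius [c r >= S + 2], so the leading term exceeds the others by at least
   [2 r ^ (d + 1) >= 2 r]. *)
exists (1 + (S + 2) / c); first by rewrite lerDl divr_ge0 ?(ltW c0) //; lra.
move=> z rz; set r := cmod z in rz *.
have Sc : 0 <= (S + 2) / c by rewrite divr_ge0 ?(ltW c0) //; lra.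
have r1 : 1 <= r by lra.
have cr : S + 2 <= c * r by rewrite mulrC -ler_pdivrMr //; lra.
have low : cmod (\sum_(i < d.+2) p`_i * z ^+ i) <= S * r ^+ d.+1.
  apply: le_trans (cmod_sum _ _) _; rewrite mulr_suml; apply: ler_sum => i _.
  rewrite cmodM cmodX ler_wpM2l ?cmod_ge0 // ler_weXn2l //.
  by rewrite -ltnS.
have -> : p.[z] = lead_coef p * z ^+ d.+2 - - (\sum_(i < d.+2) p`_i * z ^+ i).
  by rewrite opprK horner_coef size_pE big_ord_recr /= lead_coefE size_pE addrC.
apply: le_trans (cmodB _ _); rewrite cmodN cmodM cmodX -/c -/r.
have rd : r <= r ^+ d.+1 by rewrite exprS ler_peMr ?exprn_ege1 //; lra.
have rd0 : 0 <= r ^+ d.+1 by rewrite exprn_ge0 //; lra.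
have : (S + 2) * r ^+ d.+1 <= c * r ^+ d.+2.
  by rewrite [r ^+ d.+2]exprS mulrA ler_wpM2r.
lra.
Qed.

(** * Normalization and conclusion *)

Lemma chebyshevT_comp_oppX (A : comNzRingType) n :
  chebyshevT A n \Po - 'X = (-1) ^+ n *: chebyshevT A n.
Proof.
suff [] : chebyshevT A n \Po - 'X = (-1) ^+ n *: chebyshevT A n /\
    chebyshevU A n \Po - 'X = - (-1) ^+ n *: chebyshevU A n by [].
elim: n => [|n [IHT IHU]]; first by rewrite /= !comp_polyC scale1r scaler0.
rewrite chebyshevTS [chebyshevU A n.+1]/=.
rewrite !(comp_polyB, comp_polyD, comp_polyM, comp_polyC, comp_polyX) IHT IHU.
rewrite -!mul_polyC [_ ^+ n.+1]exprS mulN1r.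
by rewrite !polyCN; split; ring.
Qed.

Lemma map_chebyshevT (A B : comNzRingType) (f : {rmorphism A -> B}) n :
  map_poly f (chebyshevT A n) = chebyshevT B n.
Proof.
suff [] : map_poly f (chebyshevT A n) = chebyshevT B n /\
    map_poly f (chebyshevU A n) = chebyshevU B n by [].
elim: n => [|n [IHT IHU]]; first by rewrite /= rmorph0 rmorph1.
rewrite !chebyshevTS /= !(rmorphB, rmorphD, rmorphM, rmorph1) /=.
by rewrite map_polyX IHT IHU.
Qed.

Lemma linearly_conjugate_map (E F : fieldType) (f : {rmorphism E -> F})
    (p q : {poly E}) :
  linearly_conjugate p q -> linearly_conjugate (map_poly f p) (map_poly f q).
Proof.
move=> [a [b [a0 ->]]]; exists (f a), (f b); split; first by rewrite fmorph_eq0.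
rewrite !map_comp_poly rmorphD /= !map_polyZ map_polyX map_polyC fmorphV.
by rewrite rmorphB /= map_polyX map_polyC.
Qed.

Lemma linearly_conjugate_opp_even (F : fieldType) (p : {poly F}) n : ~~ odd n ->
  linearly_conjugate p (- chebyshevT F n) -> linearly_conjugate p (chebyshevT F n).
Proof.
move=> n_even [a [b [a0 TE]]]; exists (- a), (- b); split; first by rewrite oppr_eq0.
have : chebyshevT F n = - ((- chebyshevT F n) \Po - 'X).
  rewrite (raddfN (comp_poly (- 'X))) opprK /= chebyshevT_comp_oppX.
  by rewrite -signr_odd (negPf n_even) scale1r.
have inner : (a^-1 *: ('X - b%:P)) \Po - 'X = (- a)^-1 *: ('X - (- b)%:P).
  rewrite comp_polyZ comp_polyB comp_polyX comp_polyC.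
  by rewrite invrN polyCN opprK scaleNr -scalerN opprD.
rewrite TE => ->; rewrite -!comp_polyA inner.
by rewrite !comp_polyD !comp_polyZ !comp_polyX !comp_polyC polyCN scaleNr opprD.
Qed.

Lemma comp_prodX_affine (F : fieldType) (h m : F) (rs : seq F) : h != 0 ->
  prodX rs \Po (h *: 'X + m%:P) = h ^+ size rs *: prodX [seq (r - m) / h | r <- rs].
Proof.
move=> h0; elim: rs => [|r rs IH] /=; first by rewrite !big_nil comp_polyC scale1r.
have step : ('X - r%:P) \Po (h *: 'X + m%:P) = h *: ('X - ((r - m) / h)%:P).
  rewrite comp_polyB comp_polyX comp_polyC scalerBr -[h *: _%:P]mul_polyC -polyCM.
  by rewrite [h * _]mulrC divfK // polyCB opprB addrA.
by rewrite !big_cons comp_polyM IH step -scalerAl -scalerAr scalerA exprS.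
Qed.

(** * Normalization to [[-1, 1]] and the multiplier bounds *)

Section RealPolynomial.
Variables (R : rcfType) (d : nat) (k a b : R) (q : {poly R}).
Hypotheses (k0 : k != 0) (ab : a < b).
Hypothesis q_split : forall c, c = a \/ c = b ->
  exists rs, [/\ size rs = d.+1, q - c%:P = k *: prodX rs
                 & forall r, r \in rs -> a <= r <= b].

(** Half-length and midpoint: [x |-> (x - m) / h] takes [[a, b]] onto [[-1, 1]] and conjugates [q]
    to [Q]. *)
Let h := (b - a) / 2.
Let m := (b + a) / 2.
Let h_gt0 : 0 < h. Proof. by have := ab; rewrite /h; lra. Qed.
Let h0 : h != 0. Proof. exact: lt0r_neq0. Qed.
Let Q := (h^-1 *: 'X + (- m / h)%:P) \Po (q \Po (h *: 'X + m%:P)).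

Let horner_Q x : Q.[x] = (q.[h * x + m] - m) / h.
Proof.
by rewrite /Q !horner_comp !(hornerZ, hornerX, hornerC, hornerD) mulrC -mulrDl.
Qed.

Let horner_deriv_Q x : Q^`().[x] = q^`().[h * x + m].
Proof.
rewrite /Q !deriv_comp !(derivD, derivZ, derivX, derivC, addr0).
rewrite !(hornerM, horner_comp, hornerZ, hornerX, hornerC, hornerD) !mulr1.
by rewrite mulrCA mulVf ?mulr1.
Qed.

Lemma linearly_conjugate_normalized : linearly_conjugate q Q.
Proof.
exists h^-1, (- m / h); split; first by rewrite invr_eq0.
rewrite /Q; congr (_ \Po (_ \Po _)); rewrite invrK scalerBr -!mul_polyC -polyCM.
by rewrite mulrCA mulfV // mulr1 polyCN opprK.
Qed.

(** The ends [e] correspond to [c = h e + m]; the substitution contributes [h ^+ d.+1] and the outer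
    map a division by [h]. *)
Let Q_split e : e ^+ 2 = 1 ->
  exists rs, [/\ size rs = d.+1, Q - e%:P = (k * h ^+ d.+1 / h) *: prodX rs
                 & forall r, r \in rs -> -1 <= r <= 1].
Proof.
move=> /sqr_eq1 e1; have [|rs [size_rs qE rs_ab]] := q_split (c := h * e + m).
  by case: e1 => ->; [right | left]; rewrite /h /m; field.
exists [seq (r - m) / h | r <- rs]; split; first by rewrite size_map.
  have qL : q \Po (h *: 'X + m%:P)
    = (k * h ^+ d.+1) *: prodX [seq (r - m) / h | r <- rs] + (h * e + m)%:P.
    have {1}-> : q = k *: prodX rs + (h * e + m)%:P by rewrite -qE subrK.
    by rewrite comp_polyD comp_polyZ comp_polyC comp_prodX_affine // size_rs scalerA.
  rewrite /Q qL comp_polyD comp_polyZ comp_polyX comp_polyC scalerDr scalerA -!addrA.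
  rewrite -[RHS]addr0; congr (_ *: _ + _); first by rewrite mulrC.
  rewrite -mul_polyC -polyCM -polyCN -!polyCD -[RHS]polyC0; congr (_%:P).
  by field.
move=> _ /mapP[r /rs_ab r_ab ->].
by rewrite ler_pdivlMr // ler_pdivrMr // /h /m; lra.
Qed.

Let K0 : k * h ^+ d.+1 / h != 0.
Proof. by rewrite !mulf_neq0 ?invr_eq0 ?expf_neq0. Qed.

Definition chebyshev_conjugate :=
  linearly_conjugate q (chebyshevT R d.+1) \/
  linearly_conjugate q (- chebyshevT R d.+1).

Let Q_chebyshev : Q = chebyshevT R d.+1 \/ Q = - chebyshevT R d.+1 ->
  chebyshev_conjugate.
Proof.
by case=> QE; [left | right]; rewrite -QE; apply: linearly_conjugate_normalized.
Qed.

Let Q_deriv x : Q = chebyshevT R d.+1 \/ Q = - chebyshevT R d.+1 ->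
  `|Q^`().[x]| = `|(chebyshevU R d.+1).[x]| * d.+1%:R.
Proof.
by case=> ->; rewrite ?derivN ?hornerN ?normrN horner_deriv_chebyshevT
  -mulr_natr normrM normr_nat.
Qed.

(** At a fixed point the hypothesis of [interior_extremal] loses its common factor [1 - x^2] and
    reads [|Q'| <= d.+1]. It yields [Q = T] or [Q = - T]; then [T^2 = x^2] at [x] gives [U^2 = 1],
    so [|Q'| = d.+1], which excludes strict inequality. *)
Lemma fixed_point_multiplier xi : a < xi < b -> q.[xi] = xi ->
  d.+1%:R <= `|q^`().[xi]| /\ (`|q^`().[xi]| = d.+1%:R -> chebyshev_conjugate).
Proof.
move=> xi_ab qxi; pose x := (xi - m) / h.
have xE : h * x + m = xi by rewrite mulrC divfK // subrK.
have Qx : Q.[x] = x by rewrite horner_Q xE qxi.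
have x1 : -1 < x < 1.
  by rewrite ltr_pdivlMr // ltr_pdivrMr // /h /m; lra.
have x2 : x ^+ 2 < 1 by nra.
rewrite -xE -horner_deriv_Q.
have cheb : `|Q^`().[x]| <= d.+1%:R ->
    Q = chebyshevT R d.+1 \/ Q = - chebyshevT R d.+1.
  move=> le; apply: (interior_extremal K0 Q_split x1); rewrite Qx //.
  rewrite mulrC ler_pM2r ?subr_gt0 // -(real_normK (num_real Q^`().[x])).
  by rewrite ler_sqr ?nnegrE.
split; last by move=> le; apply/Q_chebyshev/cheb; rewrite le.
rewrite leNgt; apply/negP => lt; have QT := cheb (ltW lt); move: lt.
suff U1 : `|(chebyshevU R d.+1).[x]| = 1 by rewrite Q_deriv // U1 mul1r ltxx.
have T2 : (chebyshevT R d.+1).[x] ^+ 2 = x ^+ 2.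
  by rewrite -{2}Qx; case: QT => ->; rewrite ?hornerN ?sqrrN.
apply/eqP; rewrite -sqrp_eq1 // real_normK ?num_real //.
have := horner_chebyshev_pythagoras x d.+1; rewrite T2 => pyth; apply/eqP.
have : 1 - x ^+ 2 != 0 by rewrite subr_eq0 eq_sym lt_eqF.
by move/mulfI; apply; apply: (addrI (x ^+ 2)); rewrite pyth; ring.
Qed.

(** The bounds on [q.[c]] together with [end_values] force [Q.[e]] to be [1] or [-1], as
    [end_extremal] requires. *)
Lemma end_multiplier c : c = a \/ c = b -> a <= q.[c] <= b ->
  d.+1%:R ^+ 2 <= `|q^`().[c]| /\
  (`|q^`().[c]| = d.+1%:R ^+ 2 -> chebyshev_conjugate).
Proof.
move=> c_ab qc; pose e := (c - m) / h.
have eE : h * e + m = c by rewrite mulrC divfK // subrK.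
have e2 : e ^+ 2 = 1.
  by rewrite /e; case: c_ab => ->; rewrite /h /m; field; apply/eqP; have := ab; lra.
have Qe : Q.[e] ^+ 2 = 1.
  apply/eqP; rewrite eq_le (end_values K0 Q_split e2).1 andbT.
  have : -1 <= Q.[e] <= 1.
    by rewrite horner_Q eE ler_pdivlMr // ler_pdivrMr // /h /m; lra.
  nra.
rewrite -eE -horner_deriv_Q.
have cheb : `|Q^`().[e]| <= d.+1%:R ^+ 2 ->
  Q = chebyshevT R d.+1 \/ Q = - chebyshevT R d.+1.
  by move=> le; apply: (end_extremal K0 Q_split e2 Qe).
split; last by move=> le; apply/Q_chebyshev/cheb; rewrite le.
rewrite leNgt; apply/negP => lt; have QT := cheb (ltW lt); move: lt.
suff U1 : `|(chebyshevU R d.+1).[e]| = d.+1%:R by rewrite Q_deriv // U1 -expr2 ltxx.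
have e1 : `|e| = 1 by case/sqr_eq1: e2 => ->; rewrite ?normrN normr1.
have [_ /(congr1 Num.norm)] := chebyshev_end d.+1 e2.
by rewrite normrM e1 mulr1 normrMn normrX e1 expr1n.
Qed.

End RealPolynomial.

Section Extrema.
Variables (R : realType) (A : set R).
Hypothesis A_nonempty : A !=set0.
Hypothesis A_closed :
  forall x, ~ A x -> exists2 r : R, 0 < r & forall y, `|y - x| < r -> ~ A y.

Lemma closed_maximum : has_ubound A -> is_maximum A (sup A).
Proof.
move=> ubA; have supA : has_sup A by split.
split; last exact: sup_upper_bound.
apply: contrapT => /A_closed[r r0 hr].
have [t At tA] := sup_adherent r0 supA.
apply: (hr t) => //; have := sup_upper_bound supA At => tS.
by rewrite distrC ger0_norm ?subr_ge0 //; lra.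
Qed.

Lemma closed_minimum : has_lbound A -> is_minimum A (inf A).
Proof.
move=> lbA; have infA : has_inf A by split.
split; last exact: ge_inf.
apply: contrapT => /A_closed[r r0 hr].
have [t At tA] := inf_adherent r0 infA.
apply: (hr t) => //; have := ge_inf lbA At => tS.
by rewrite ger0_norm ?subr_ge0 //; lra.
Qed.

End Extrema.

(** * Reduction to a real polynomial when [K] is real *)

Section RealJulia.
Variables (R : realType) (d : nat) (p : {poly R[i]}).
Hypothesis size_p : size p = d.+3.
Variable rho : R.
Hypothesis rho_ge1 : 1 <= rho.
Hypothesis escape : forall z, rho <= cmod z -> 2 * cmod z <= cmod p.[z].
Local Notation K := (filled p rho).
Hypothesis K_real : forall z, K z -> exists x : R, z = x%:C.

Let A : set R := [set x | K x%:C].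

(** A fixed point of [p] lies in [K]: outside the disc, [escape] would double its modulus. *)
Lemma filled_nonempty : A !=set0.
Proof.
have [|z /rootP] := closed_rootP (p - 'X) _.
  by rewrite size_polyDl size_p // size_polyN size_polyX.
rewrite hornerD hornerN hornerX => /eqP; rewrite subr_eq0 => /eqP pz.
have zK : K z.
  move=> n; have -> : iter n (horner p) z = z by elim: n => //= n ->.
  have rho1 := rho_ge1.
  rewrite leNgt; apply/negP => rz; have := escape (ltW rz); rewrite pz; lra.
by have [x zx] := K_real zK; exists x; rewrite /A /= -zx.
Qed.

Lemma filled_bounded x : A x -> `|x| <= rho.
Proof. by move=> /(_ 0%N); rewrite /= -cmod_real. Qed.

Lemma filled_closed x : ~ A x -> exists2 r : R, 0 < r & forall y, `|y - x| < r -> ~ A y.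
Proof.
move=> /not_filled[N /escape_open[r r0 hr]]; exists r => // y yx.
have /hr : cmod (y%:C - x%:C) < r by rewrite -rmorphB cmod_real.
by move=> h /(_ N); rewrite leNgt h.
Qed.

Lemma bounded_filled z M : (forall n, cmod (iter n (horner p) z) <= M) -> K z.
Proof.
have rho1 := rho_ge1.
move=> zM N; rewrite leNgt; apply/negP => zN.
have [k hk] := exp2_unbounded (M + 1).
have := escape_iter escape k (ltW zN); rewrite -iterD => hM.
have := zM (k + N)%N.
have : 2 ^+ k <= 2 ^+ k * cmod (iter N (horner p) z).
  by rewrite ler_peMr ?exprn_ge0 //; lra.
lra.
Qed.

Variables a b : R.
Hypotheses (a_min : is_minimum A a) (b_max : is_maximum A b).

(** Preimages of a point of [K] lie in [K] by [filled_horner], hence are real. *)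
Lemma filled_split c : A c -> exists rs,
  [/\ size rs = d.+2,
      p - (c%:C)%:P = lead_coef p *: map_poly (real_complex R) (prodX rs)
    & forall r, r \in rs -> A r].
Proof.
move=> Ac; have [zs zsE] := closed_field_poly_normal (p - (c%:C)%:P).
have szC : (size (- ((c%:C)%:P : {poly R[i]})) < size p)%N.
  by rewrite size_polyN size_p (leq_ltn_trans (size_polyC_leq1 _)).
rewrite lead_coefDl // in zsE.
have zsK z : z \in zs -> K z.
  move=> z_in; apply/(filled_horner rho_ge1 escape).
  suff -> : p.[z] = c%:C by [].
  apply/eqP; rewrite -subr_eq0 -(hornerC c%:C z) -hornerN -hornerD zsE hornerZ.
  by apply/eqP; rewrite (rootP _) ?mulr0 // root_prod_XsubC.
have zsR z : z \in zs -> (complex.Re z)%:C = z by move=> /zsK/K_real[x ->].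
exists [seq complex.Re z | z <- zs]; split.
- have := congr1 (fun q : {poly R[i]} => size q) zsE.
  rewrite size_polyDl // size_p size_scale ?size_prod_XsubC ?size_map; first by case.
  by rewrite lead_coef_eq0 -size_poly_eq0 size_p.
- rewrite {1}zsE; congr (_ *: _); rewrite rmorph_prod big_map.
  apply: eq_big_seq => z z_in.
  by rewrite rmorphB /= map_polyX map_polyC /= zsR.
by move=> _ /mapP[z z_in ->]; rewrite /A /= zsR //; apply: zsK.
Qed.

(* Otherwise [p = lead_coef p * ('X - a) ^ d + a], whose fixed point [a] is
   superattracting. *)
Lemma minimum_lt_maximum : a < b.
Proof.
have [Aa mina] := a_min; have [Ab maxb] := b_max.
rewrite lt_neqAle mina // andbT; apply/eqP => ab.
have [rs [size_rs pE rsA]] := filled_split Aa.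
have rs_a r : r \in rs -> r = a.
  by move=> /rsA Ar; apply/eqP; rewrite eq_le mina // andbT ab maxb.
have pz z : p.[z] - a%:C = lead_coef p * (z - a%:C) ^+ d.+2.
  have := congr1 (horner^~ z) pE.
  rewrite hornerD hornerN hornerC hornerZ => ->; congr (_ * _).
  rewrite rmorph_prod horner_prod -size_rs big_seq.
  rewrite (eq_bigr (fun=> z - a%:C)) => [|r /rs_a ->]; last first.
    by rewrite rmorphB /= map_polyX map_polyC /= hornerXsubC.
  by rewrite -big_seq big_const_seq count_predT -Monoid.iteropE.
pose c := cmod (lead_coef p); have c0 : 0 <= c := cmod_ge0 _.
(* Since [c e <= 1], the disc of radius [e] about [a] is mapped into itself; it contains the nonreal
   point [a + i e]. *)
pose e := (1 + c)^-1; have e0 : 0 < e by rewrite invr_gt0; lra.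
have ce : e * (1 + c) = 1 by rewrite mulVf //; apply/eqP; lra.
have near n : cmod (iter n (horner p) (Complex a e) - a%:C) <= e.
  elim: n => [|n IH] /=.
    by rewrite subrr subr0 expr0n add0r sqrtr_sqr ger0_norm // ltW.
  rewrite pz cmodM cmodX -/c; set r := cmod _ in IH *.
  have r0 : 0 <= r := cmod_ge0 _.
  have r1 : r <= 1 by nra.
  have rd : r ^+ d.+2 <= r * r.
    by rewrite !exprS ler_wpM2l // ler_piMr // exprn_ile1.
  by have : c * r ^+ d.+2 <= c * (r * r); [apply: ler_wpM2l | nra].
have /K_real[x] : K (Complex a e).
  apply: (@bounded_filled _ (cmod a%:C + e)) => n.
  by have := cmodB (iter n (horner p) (Complex a e)) a%:C; have := near n; lra.
by case=> _ e_eq0; rewrite e_eq0 ltxx in e0.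
Qed.

(** Evaluating [p - b] at a real preimage [r] of [a] gives [a - b = lead_coef p * P] with [P] real;
    as [a != b], the leading coefficient is real. Forward invariance of [K] bounds [q.[c]]. *)
Lemma filled_real_polynomial : exists k q,
  [/\ k != 0, p = map_poly (real_complex R) q
    & forall c, c = a \/ c = b -> a <= q.[c] <= b /\ exists rs,
        [/\ size rs = d.+2, q - c%:P = k *: prodX rs
          & forall r, r \in rs -> a <= r <= b]].
Proof.
have [Aa mina] := a_min; have [Ab maxb] := b_max.
have [rs [size_rs pEa rsA]] := filled_split Aa.
have [rs' [size_rs' pEb rsA']] := filled_split Ab.
pose r := head 0 rs.
have r_in : r \in rs by rewrite /r; case: (rs) size_rs => //= *; apply: mem_head.
pose P := (prodX rs').[r]; have C := @complexI R.
have ab := minimum_lt_maximum.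
have lcE : (a - b)%:C = lead_coef p * P%:C.
  have := congr1 (horner^~ r%:C) pEb; rewrite hornerZ horner_map -/P => <-.
  have := congr1 (horner^~ r%:C) pEa; rewrite hornerZ horner_map.
  have /rootP -> : root (prodX rs) r by rewrite root_prod_XsubC.
  rewrite mulr0 !hornerD !hornerN !hornerC rmorphB => /eqP.
  by rewrite subr_eq0 => /eqP ->.
have P0 : P != 0.
  apply/eqP => P0; move: lcE; rewrite P0 mulr0 => /C; lra.
pose k := (a - b) / P.
have kE : lead_coef p = k%:C.
  by rewrite /k rmorphM fmorphV /= lcE mulfK // (inj_eq C P 0).
pose q := k *: prodX rs + a%:P.
have pE : p = map_poly (real_complex R) q.
  by rewrite rmorphD /= map_polyZ map_polyC /= -kE -pEa subrK.
exists k, q; split=> //.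
  by rewrite -(inj_eq C k 0) -kE lead_coef_eq0 -size_poly_eq0 size_p.
move=> c cab; have Ac : A c by case: cab => ->.
have /andP : a <= q.[c] /\ q.[c] <= b.
  have Aqc : A q.[c].
    rewrite /A /= -horner_map -pE; exact/(filled_horner rho_ge1 escape).
  by split; [apply: mina | apply: maxb].
split=> //; have [ts [size_ts tsE tsA]] := filled_split Ac; exists ts; split=> //.
  apply: (map_inj_poly C (rmorph0 _)).
  by rewrite rmorphB /= map_polyZ map_polyC -pE tsE kE.
by move=> t /tsA At; rewrite mina ?maxb.
Qed.

End RealJulia.

(** The alternative [- T_d] is kept for odd [d], as [- T_3] shows: it attains equality at the fixed
    point [0] without being conjugate to [T_3]. *)
Theorem theorem4p1 (R : realType) (d : nat) (p : {poly R[i]})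
    (d_gt1 : (1 < d)%N) (deg_p : size p = d.+1)
    (julia_real : julia p `<=` [set x%:C | x in [set: R]]) :
  exists a b : R,
    [/\ is_minimum (real_trace (julia p)) a,
        is_maximum (real_trace (julia p)) b,
        [/\ forall xi : R, a < xi -> xi < b -> p.[xi%:C] = xi%:C ->
              d%:R <= cmod p^`().[xi%:C],
            d%:R ^+ 2 <= cmod p^`().[a%:C]
          & d%:R ^+ 2 <= cmod p^`().[b%:C]]
      & [\/ exists xi : R, [/\ a < xi, xi < b, p.[xi%:C] = xi%:C
              & cmod p^`().[xi%:C] = d%:R],
            cmod p^`().[a%:C] = d%:R ^+ 2
          | cmod p^`().[b%:C] = d%:R ^+ 2] ->
        linearly_conjugate p (chebyshevT R[i] d) \/
        odd d /\ linearly_conjugate p (- chebyshevT R[i] d)].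
Proof.
case: d d_gt1 deg_p => [|[|d]] // _ size_p.
have [|rho rho_ge1 escape] := @escape_radius _ p; first by rewrite size_p.
have JK := julia_filled rho_ge1 escape julia_real.
have K_real z : filled p rho z -> exists x : R, z = x%:C.
  by rewrite -JK => /julia_real[x _ <-]; exists x.
rewrite JK /real_trace.
have ne := filled_nonempty size_p rho_ge1 escape K_real.
have cl := filled_closed (p := p) (rho := rho).
have bd := filled_bounded (p := p) (rho := rho).
have a_min := closed_minimum ne cl _.
have b_max := closed_maximum ne cl _.
set A := [set x : R | _] in a_min b_max bd *.
have {}a_min : is_minimum A (inf A).
  by apply: a_min; exists (- rho) => x /bd; rewrite ler_norml => /andP[].
have {}b_max : is_maximum A (sup A).
  by apply: b_max; exists rho => x /bd; rewrite ler_norml => /andP[].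
set a := inf A in a_min *; set b := sup A in b_max *.
have ab := minimum_lt_maximum size_p rho_ge1 escape K_real a_min b_max.
have [k [q [k0 pE q_ends]]] :=
  filled_real_polynomial size_p rho_ge1 escape K_real a_min b_max.
exists a, b.
have q_split c : c = a \/ c = b -> exists rs,
    [/\ size rs = d.+2, q - c%:P = k *: prodX rs
      & forall r, r \in rs -> a <= r <= b] by move=> /q_ends[].
have pd x : cmod p^`().[x%:C] = `|q^`().[x]|.
  by rewrite pE deriv_map horner_map cmod_real.
have pfix x : p.[x%:C] = x%:C -> q.[x] = x.
  by rewrite pE horner_map => /complexI.
have conj : chebyshev_conjugate d.+1 q ->
    linearly_conjugate p (chebyshevT R[i] d.+2) \/
    odd d.+2 /\ linearly_conjugate p (- chebyshevT R[i] d.+2).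
  case=> /(linearly_conjugate_map (real_complex R)); rewrite -pE.
    by rewrite map_chebyshevT; left.
  have -> : map_poly (real_complex R) (- chebyshevT R d.+2) = - chebyshevT R[i] d.+2.
    by rewrite -(map_chebyshevT (real_complex R)); apply: rmorphN.
  move=> conjN.
  have [odd_d|even_d] := boolP (odd d.+2); first by right.
  by left; apply: linearly_conjugate_opp_even even_d conjN.
(* The degree is now [d.+2], which the normalized lemmas write as the successor of their parameter;
   hence [d.+1]. *)
have fixP xi := @fixed_point_multiplier _ d.+1 k a b q k0 ab q_split xi.
have endP c (h : c = a \/ c = b) :=
  @end_multiplier _ d.+1 k a b q k0 ab q_split c h (q_ends c h).1.
split=> //; first split.
- by move=> xi axi xib /pfix qxi; rewrite pd; apply: (fixP _ _ qxi).1; rewrite axi.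
- by rewrite pd; apply: (endP a (or_introl erefl)).1.
- by rewrite pd; apply: (endP b (or_intror erefl)).1.
case=> [[xi [axi xib /pfix qxi]]| |]; rewrite pd => eq; apply: conj.
- by apply: (fixP _ _ qxi).2; rewrite ?axi.
- exact: (endP a (or_introl erefl)).2.
- exact: (endP b (or_intror erefl)).2.
Qed.
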